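(* Let $\mu\in\mathbb{R}$, $\mu\neq 0$. Then there is no (non-empty) $4$-dimensional almost-Hermitian manifold $\mathcal{H}=(M,g,J)$ such that, for every $P\in M$, the curvature model $(T_PM,g_P,J_P,R_P)$ is isomorphic to $\mathfrak{C}_\mu^4$.
   Context: An almost-Hermitian manifold $(M,g,J)$ is a Riemannian manifold $(M,g)$ with a smooth endomorphism $J$ of $TM$ satisfying $J^2=-\mathrm{Id}$ and $g(Jx,Jy)=g(x,y)$. With $\nabla$ the Levi-Civita connection, $R(x,y)=\nabla_x\nabla_y-\nabla_y\nabla_x-\nabla_{[x,y]}$ and $R(x,y,z,w)=g(R(x,y)z,w)$. An isomorphism of curvature models $(V,\langle\cdot,\cdot\rangle,J,A)$ is a linear isometry intertwining the $J$'s and pulling back one curvature tensor to the other. The model $\mathfrak{C}_\mu^4=(V,\langle\cdot,\cdot\rangle,J,C)$: $V$ is a $4$-dimensional real inner product space with an orthogonal complex structure $J$ and an orthonormal basis $\{x_1,Jx_1,x_2,Jx_2\}$; the non-zero components of $C$ are determined, modulo the symmetries $C(x,y,z,w)=-C(y,x,z,w)=C(z,w,x,y)$, for $i\neq j$ by $C(x_i,Jx_i,Jx_i,x_i)=\mu$, $C(x_i,x_j,x_j,x_i)=-\frac{\mu}{2}$, $C(Jx_i,x_j,x_j,Jx_i)=\frac{\mu}{2}$, $C(Jx_i,Jx_j,Jx_j,Jx_i)=-\frac{\mu}{2}$, $C(x_i,x_j,Jx_j,Jx_i)=-\frac{\mu}{2}$, $C(x_i,Jx_j,Jx_i,x_j)=\frac{\mu}{2}$,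 $C(x_i,Jx_i,Jx_j,x_j)=0$; all components not obtained from these vanish. *)

(* Defs.v *)
From HB Require Import structures.
From mathcomp Require Import all_boot all_order all_algebra.
From mathcomp Require Import all_classical all_reals all_analysis.

Set Implicit Arguments.
Unset Strict Implicit.
Unset Printing Implicit Defensive.

Import Order.TTheory GRing.Theory Num.Theory.
Import numFieldNormedType.Exports.

Local Open Scope classical_set_scope.
Local Open Scope ring_scope.

(* ---------------------------------------------------------------------- *)
(* Smooth maps between normed spaces                                      *)
(* ---------------------------------------------------------------------- *)

(* Only meant for an open set U. *)
Fixpoint Ck (R : realType) (V W : normedModType R) (k : nat) (U : set V)
    (f : V -> W) : Prop :=
  match k with
  | 0 => forall x, U x -> {for x, continuous f}
  | k'.+1 => (forall x, U x -> differentiable f x) /\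
             (forall v, Ck k' U (fun x => 'D_v f x))
  end.

Definition smooth (R : realType) (V W : normedModType R) (U : set V)
    (f : V -> W) : Prop := forall k, Ck k U f.

(* ---------------------------------------------------------------------- *)
(* Smooth manifolds                                                       *)
(* ---------------------------------------------------------------------- *)

(* The values of cmap outside cdom and of cinv outside cimg are irrelevant. *)
Record chart (R : realType) (n : nat) (M : topologicalType) := Chart {
  cdom : set M;
  cimg : set 'rV[R]_n;
  cmap : M -> 'rV[R]_n;
  cinv : 'rV[R]_n -> M;
  cdom_open : open cdom;
  cimg_open : open cimg;
  cmap_img : forall P, cdom P -> cimg (cmap P);
  cinv_dom : forall q, cimg q -> cdom (cinv q);
  cmapK : forall P, cdom P -> cinv (cmap P) = P;
  cinvK : forall q, cimg q -> cmap (cinv q) = q;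
  cmap_continuous : forall P, cdom P -> {for P, continuous cmap};
  cinv_continuous : forall q, cimg q -> {for q, continuous cinv} }.

(* The atlas need not be maximal: it is any atlas of the smooth structure. *)
Record manifold (R : realType) (n : nat) := Manifold {
  mpoint :> topologicalType;
  atlas : set (chart R n mpoint);
  manifold_hausdorff : hausdorff_space mpoint;
  manifold_second_countable : @second_countable mpoint;
  atlas_cover : forall P : mpoint, exists c, atlas c /\ cdom c P;
  atlas_compatible : forall c d, atlas c -> atlas d ->
    smooth (cmap c @` (cdom c `&` cdom d)) (cmap d \o cinv c) }.

Definition smooth_fun (R : realType) (n : nat) (M : manifold R n) (U : set M)
    (f : M -> R) : Prop :=
  forall c, atlas c ->
    smooth (cmap c @` (U `&` cdom c)) (f \o cinv c : 'rV[R]_n -> R).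

(* ---------------------------------------------------------------------- *)
(* Tangent spaces                                                         *)
(* ---------------------------------------------------------------------- *)

(* A tangent vector at P is the family of its coordinate vectors in all the
   charts of the atlas around P, any two of them being related by the
   differential of the transition map; the entries at the other charts are
   set to 0, so that equality of tangent vectors is equality of families. *)
Definition is_tangent (R : realType) (n : nat) (M : manifold R n) (P : M) :
    {pred chart R n M -> 'rV[R]_n} :=
  fun v => `[< (forall c, ~ (atlas c /\ cdom c P) -> v c = 0) /\
    (forall c d, atlas c -> cdom c P -> atlas d -> cdom d P ->
       v d = 'd (cmap d \o cinv c) (cmap c P) (v c)) >].

Lemma is_tangent_submod (R : realType) (n : nat) (M : manifold R n) (P : M) :
  submod_closed (is_tangent P).
Proof.
split.
  by apply/asboolP; split=> // c d ? ? ? ?; rewrite linear0.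
move=> a u v /asboolP[u0 uE] /asboolP[v0 vE]; apply/asboolP; split.
  by move=> c Pc; rewrite !fctE u0// v0// scaler0 addr0.
by move=> c d Ac Pc Ad Pd; rewrite !fctE (uE c d)// (vE c d)// linearP.
Qed.

HB.instance Definition _ (R : realType) (n : nat) (M : manifold R n) (P : M) :=
  GRing.isSubmodClosed.Build R (chart R n M -> 'rV[R]_n) (is_tangent P)
    (is_tangent_submod P).

Record tangent (R : realType) (n : nat) (M : manifold R n) (P : M) := Tangent {
  tcoord : chart R n M -> 'rV[R]_n;
  tcoordP : tcoord \in is_tangent P }.

HB.instance Definition _ (R : realType) (n : nat) (M : manifold R n) (P : M) :=
  [isSub for @tcoord R n M P].
HB.instance Definition _ (R : realType) (n : nat) (M : manifold R n) (P : M) :=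
  [Choice of tangent P by <:].
HB.instance Definition _ (R : realType) (n : nat) (M : manifold R n) (P : M) :=
  [SubChoice_isSubLmodule of tangent P by <:].

Definition chart_at (R : realType) (n : nat) (M : manifold R n) (P : M) :
    chart R n M := sval (cid (atlas_cover P)).

(* The derivative v(f) of a function f, smooth near P, along a tangent vector
   v at P; it does not depend on the chart in which it is computed. *)
Definition tder (R : realType) (n : nat) (M : manifold R n) (P : M)
    (v : tangent P) (f : M -> R) : R :=
  let c := chart_at P in
  'd (f \o cinv c : 'rV[R]_n -> R) (cmap c P) (tcoord v c).

(* ---------------------------------------------------------------------- *)
(* Vector fields                                                          *)
(* ---------------------------------------------------------------------- *)

(* A vector field on an open set U is a total field whose values outside U
   are disregarded. *)
Definition vfield (R : realType) (n : nat) (M : manifold R n) : Type :=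
  forall P : M, tangent P.

Definition smooth_field (R : realType) (n : nat) (M : manifold R n)
    (U : set M) (X : vfield M) : Prop :=
  forall c, atlas c ->
    smooth (cmap c @` (U `&` cdom c)) (fun q => tcoord (X (cinv c q)) c).

Definition fder (R : realType) (n : nat) (M : manifold R n) (X : vfield M)
    (f : M -> R) : M -> R := fun P => tder (X P) f.

(* [X, Y]_P is the tangent vector with [X, Y]_P(f) = X_P(Y f) - Y_P(X f) for
   all functions f that are smooth near P. *)
Definition lie_bracket (R : realType) (n : nat) (M : manifold R n)
    (X Y : vfield M) : vfield M :=
  fun P => xget 0 [set w : tangent P | forall (U : set M) (f : M -> R),
    open U -> U P -> smooth_fun U f ->
    tder w f = tder (X P) (fder Y f) - tder (Y P) (fder X f)].

(* ---------------------------------------------------------------------- *)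
(* Almost-Hermitian manifolds                                             *)
(* ---------------------------------------------------------------------- *)

Record almost_hermitian (R : realType) (n : nat) := AlmostHermitian {
  ah_manifold :> manifold R n;
  metric : forall P : ah_manifold, tangent P -> tangent P -> R;
  metric_linear : forall (P : ah_manifold) (a : R) (x y z : tangent P),
    metric (a *: x + y) z = a * metric x z + metric y z;
  metric_sym : forall (P : ah_manifold) (x y : tangent P),
    metric x y = metric y x;
  metric_posdef : forall (P : ah_manifold) (x : tangent P),
    x != 0 -> 0 < metric x x;
  metric_smooth : forall (U : set ah_manifold) (X Y : vfield ah_manifold),
    open U -> smooth_field U X -> smooth_field U Y ->
    smooth_fun U (fun P => metric (X P) (Y P));
  cplx : forall P : ah_manifold, tangent P -> tangent P;
  cplx_linear : forall (P : ah_manifold) (a : R) (x y : tangent P),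
    cplx (a *: x + y) = a *: cplx x + cplx y;
  cplx_smooth : forall (U : set ah_manifold) (X : vfield ah_manifold),
    open U -> smooth_field U X -> smooth_field U (fun P => cplx (X P));
  cplxK : forall (P : ah_manifold) (x : tangent P), cplx (cplx x) = - x;
  cplx_orthogonal : forall (P : ah_manifold) (x y : tangent P),
    metric (cplx x) (cplx y) = metric x y }.

(* The operator nabla X Y is only constrained on open sets on which X and Y
   are smooth. *)
Record levi_civita (R : realType) (n : nat) (H : almost_hermitian R n)
    (nabla : vfield H -> vfield H -> vfield H) : Prop := LeviCivita {
  nabla_smooth : forall (U : set H) (X Y : vfield H),
    open U -> smooth_field U X -> smooth_field U Y ->
    smooth_field U (nabla X Y);
  nabla_addl : forall (U : set H) (X Y Z : vfield H) (P : H),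
    open U -> smooth_field U X -> smooth_field U Y -> smooth_field U Z ->
    U P -> nabla (fun Q => X Q + Y Q) Z P = nabla X Z P + nabla Y Z P;
  nabla_scalel : forall (U : set H) (f : H -> R) (X Y : vfield H) (P : H),
    open U -> smooth_fun U f -> smooth_field U X -> smooth_field U Y ->
    U P -> nabla (fun Q => f Q *: X Q) Y P = f P *: nabla X Y P;
  nabla_addr : forall (U : set H) (X Y Z : vfield H) (P : H),
    open U -> smooth_field U X -> smooth_field U Y -> smooth_field U Z ->
    U P -> nabla X (fun Q => Y Q + Z Q) P = nabla X Y P + nabla X Z P;
  nabla_leibniz : forall (U : set H) (f : H -> R) (X Y : vfield H) (P : H),
    open U -> smooth_fun U f -> smooth_field U X -> smooth_field U Y ->
    U P -> nabla X (fun Q => f Q *: Y Q) P =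
           fder X f P *: Y P + f P *: nabla X Y P;
  nabla_torsion_free : forall (U : set H) (X Y : vfield H) (P : H),
    open U -> smooth_field U X -> smooth_field U Y ->
    U P -> nabla X Y P - nabla Y X P = lie_bracket X Y P;
  nabla_metric : forall (U : set H) (X Y Z : vfield H) (P : H),
    open U -> smooth_field U X -> smooth_field U Y -> smooth_field U Z ->
    U P -> fder X (fun Q => metric (Y Q) (Z Q)) P =
           metric (nabla X Y P) (Z P) + metric (Y P) (nabla X Z P) }.

Definition curvature_op (R : realType) (n : nat) (M : manifold R n)
    (nabla : vfield M -> vfield M -> vfield M) (X Y Z : vfield M) : vfield M :=
  fun P => nabla X (nabla Y Z) P - nabla Y (nabla X Z) P
           - nabla (lie_bracket X Y) Z P.

(* Every tangent vector extends to a smooth local vector field, hence this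
   determines Rm. *)
Definition curvature_tensor (R : realType) (n : nat) (H : almost_hermitian R n)
    (nabla : vfield H -> vfield H -> vfield H)
    (Rm : forall P : H, tangent P -> tangent P -> tangent P -> tangent P -> R) :
    Prop :=
  forall (U : set H) (X Y Z W : vfield H) (P : H), open U ->
    smooth_field U X -> smooth_field U Y -> smooth_field U Z ->
    smooth_field U W -> U P ->
    Rm P (X P) (Y P) (Z P) (W P) =
    metric (curvature_op nabla X Y Z P) (W P).

(* ---------------------------------------------------------------------- *)
(* Curvature models                                                       *)
(* ---------------------------------------------------------------------- *)

Record curvature_model (R : realType) := CurvatureModel {
  cm_space : lmodType R;
  cm_ip : cm_space -> cm_space -> R;
  cm_cplx : cm_space -> cm_space;
  cm_curv : cm_space -> cm_space -> cm_space -> cm_space -> R }.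

Definition model_iso (R : realType) (m1 m2 : curvature_model R) : Prop :=
  exists f : {linear cm_space m1 -> cm_space m2},
    [/\ bijective f,
        forall x y, cm_ip (f x) (f y) = cm_ip x y,
        forall x, f (cm_cplx x) = cm_cplx (f x) &
        forall x y z w, cm_curv (f x) (f y) (f z) (f w) = cm_curv x y z w].

Definition model_at (R : realType) (n : nat) (H : almost_hermitian R n)
    (Rm : forall P : H, tangent P -> tangent P -> tangent P -> tangent P -> R)
    (P : H) : curvature_model R :=
  CurvatureModel (@metric R n H P) (@cplx R n H P) (Rm P).

Definition modelled_on (R : realType) (n : nat) (H : almost_hermitian R n)
    (m : curvature_model R) : Prop :=
  exists nabla Rm, [/\ levi_civita nabla, @curvature_tensor R n H nabla Rm &
    forall P : H, model_iso (model_at Rm P) m].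

(* ---------------------------------------------------------------------- *)
(* The model C_mu^4                                                       *)
(* ---------------------------------------------------------------------- *)

(* The standard basis of 'rV_4, with indices 0, 1, 2, 3, is
   x_1, J x_1, x_2, J x_2; the indices i, j of x_i, x_j are 0 and 1. *)
Definition C4_x (i : nat) : nat := i.*2.
Definition C4_Jx (i : nat) : nat := i.*2.+1.

Definition C4_listed (R : realType) (mu : R) : seq ((nat * nat * nat * nat) * R) :=
  flatten [seq
    let: (i, j) := ij in let x := C4_x in let Jx := C4_Jx in
    [:: ((x i, Jx i, Jx i, x i), mu);
        ((x i, x j, x j, x i), - (mu / 2));
        ((Jx i, x j, x j, Jx i), mu / 2);
        ((Jx i, Jx j, Jx j, Jx i), - (mu / 2));
        ((x i, x j, Jx j, Jx i), - (mu / 2));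
        ((x i, Jx j, Jx i, x j), mu / 2);
        ((x i, Jx i, Jx j, x j), 0)]
  | ij <- [:: (0, 1); (1, 0)]%N].

Definition C4_lookup (R : realType) (mu : R) (q : nat * nat * nat * nat) :
    option R := ohead [seq e.2 | e <- C4_listed mu & e.1 == q].

(* The component with indices a, b, c, d: if one of the images of (a, b, c, d)
   under the symmetries is listed, the corresponding signed value, else 0. *)
Definition C4_comp (R : realType) (mu : R) (a b c d : nat) : R :=
  let listed p q r s := C4_lookup mu (p, q, r, s) in
  if listed a b c d is Some r then r else
  if listed b a c d is Some r then - r else
  if listed a b d c is Some r then - r else
  if listed b a d c is Some r then r else
  if listed c d a b is Some r then r else
  if listed d c a b is Some r then - r else
  if listed c d b a is Some r then - r else
  if listed d c b a is Some r then r else 0.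

(* The listed values are mutually consistent. *)
Lemma C4_comp_listed (R : realType) (mu : R) (i j : 'I_2) :
  let x := C4_x in let Jx := C4_Jx in let C := C4_comp mu in i != j ->
  [/\ C (x i) (Jx i) (Jx i) (x i) = mu,
      C (x i) (x j) (x j) (x i) = - (mu / 2),
      C (Jx i) (x j) (x j) (Jx i) = mu / 2 &
      C (Jx i) (Jx j) (Jx j) (Jx i) = - (mu / 2)] /\
  [/\ C (x i) (x j) (Jx j) (Jx i) = - (mu / 2),
      C (x i) (Jx j) (Jx i) (x j) = mu / 2 &
      C (x i) (Jx i) (Jx j) (x j) = 0].
Proof. by case: i j => -[|[|//]] ? [[|[|//]] ?]. Qed.

Lemma C4_comp_sym (R : realType) (mu : R) (a b c d : 'I_4) :
  C4_comp mu a b c d = - C4_comp mu b a c d /\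
  C4_comp mu a b c d = C4_comp mu c d a b.
Proof.
case: a => -[|[|[|[|//]]]] ?; case: b => -[|[|[|[|//]]]] ?;
case: c => -[|[|[|[|//]]]] ?; case: d => -[|[|[|[|//]]]] ?;
by rewrite /C4_comp /= ?oppr0 ?opprK.
Qed.

Definition C4_ip (R : realType) (x y : 'rV[R]_4) : R :=
  \sum_(a < 4) x 0 a * y 0 a.

(* J maps the basis vector x_i to J x_i and J x_i to - x_i. *)
Definition C4_J (R : realType) (x : 'rV[R]_4) : 'rV[R]_4 :=
  \row_(a < 4) (if odd a then x 0 (inord a.-1) else - x 0 (inord a.+1)).

Definition C4_curv (R : realType) (mu : R) (x y z w : 'rV[R]_4) : R :=
  \sum_(a < 4) \sum_(b < 4) \sum_(c < 4) \sum_(d < 4)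
    C4_comp mu a b c d * x 0 a * y 0 b * z 0 c * w 0 d.

Definition C4 (R : realType) (mu : R) : curvature_model R :=
  CurvatureModel (@C4_ip R) (@C4_J R) (C4_curv mu).

(* Main.v *)
Require Import Defs.
From mathcomp Require Import all_boot all_order all_algebra.
From mathcomp Require Import all_classical all_reals all_analysis.
From mathcomp Require Import ring lra.
From mathcomp.real_closed Require Import mxtens.

Set Implicit Arguments.
Unset Strict Implicit.
Unset Printing Implicit Defensive.

Import Order.TTheory GRing.Theory Num.Theory.
Import numFieldNormedType.Exports.

Local Open Scope classical_set_scope.
Local Open Scope ring_scope.

(* Up to an overall sign, the curvature operator of the model has eigenvalues
   mu, 0, 0 on the self-dual and mu, -mu, mu on the anti-self-dual two-forms,
   and the Ricci tensor is mu times the metric. Every tangent space carries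
   this model, so the curvature operator N of the manifold, acting on
   2-tensors (which doubles the eigenvalues), satisfies N^3 = 4 mu^2 N and has
   constant Ricci contraction. Differentiating these two identities at a point,
   in a frame that is orthonormal and has vanishing covariant derivative there,
   leaves 16 unknown components of nabla R, and the second Bianchi identity
   forces them to vanish: nabla R = 0 everywhere. Hence R(u, v) acts trivially
   on R, which is false for the model because its curvature operator is not
   scalar on the anti-self-dual forms.

   Lie brackets only enter through the torsion-free identity, so that no
   symmetry of second derivatives is needed. *)

(** * Smooth maps *)

(** The isomorphisms with the model are given point by point and need not vary continuously, so a
    frame in which the curvature has the components of the model cannot be differentiated. What can
    be differentiated are conjugation-invariant identities, written in a smooth frame; the cubic
    identity and the Ricci contraction are two of them. Raising two indices with the inverse Gram
    matrix keeps N conjugate to the model although the smooth frame is orthonormal only at the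
    point. The cubic is useful because X^3 - 4 mu^2 X has the simple roots 0, 2 mu and -2 mu: its
    derivative says that T, the derivative of N, pairs each eigenspace trivially with itself. The
    blocks between different eigenspaces stay free, and the Ricci identity removes from them the
    mixing of self-dual with anti-self-dual forms. What survives are the infinitesimal rotations of
    two lines, the simple eigenline in each half: four numbers for each of the four directions of
    differentiation. *)

Lemma near_eq_diff (R : realType) (V W : normedModType R) (f g : V -> W) x :
  (\near x, f x = g x) -> differentiable f x ->
  differentiable g x /\ forall v, 'd g x v = 'd f x v.
Proof.
move=> fg df.
have cf := diff_continuous df.
(* The differential is characterised by its first-order expansion, which depends only on the germ at
   [x]; [diff_unique] then identifies it. *)
have E : g \o shift x = cst (g x) + 'd f x +o_ (0 : V) id.
  apply/eqaddoP => e e0.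
  have := diff_locally df; move/eqaddoP => /(_ e e0) H.
  have fgx : f x = g x by exact: nbhs_singleton fg.
  have fg0 : \forall y \near (0 : V), f (y + x) = g (y + x).
    by move: fg; rewrite (near_shift 0) /=; near_simpl; apply: filterS => y /=; rewrite subr0.
  near=> y.
  have := near H y; rewrite /= => H1.
  have -> : (g \o shift x - (cst (g x) + 'd f x)) y =
    (f \o shift x - (cst (f x) + 'd f x)) y.
    by rewrite !fctE /= fgx (near fg0 y).
  exact: H1.
have Dg := diff_unique cf E.
by split; [apply/diff_locallyP; split; rewrite Dg|rewrite Dg].
Unshelve. all: by end_near. Qed.

Section Ck_theory.
Variable R : realType.

Lemma Ck_sub (V W : normedModType R) k (U U' : set V) (f : V -> W) :
  U' `<=` U -> Ck k U f -> Ck k U' f.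
Proof.
move=> sU; elim: k f => [|k IH] f /=; first by move=> H x /sU; apply: H.
by move=> [df Df]; split=> [x /sU/df|v]//; apply: IH.
Qed.

Lemma Ck_ext (V W : normedModType R) k (U : set V) (f g : V -> W) :
  open U -> (forall x, U x -> f x = g x) -> Ck k U f -> Ck k U g.
Proof.
move=> oU; elim: k f g => [|k IH] f g /= fg.
  move=> H x Ux; have Hx : f @ x --> f x := H x Ux.
  rewrite (fg x Ux) in Hx; apply: cvg_trans Hx; apply: near_eq_cvg.
  by near do apply: fg; exact: open_nbhs_nbhs.
have nfg x : U x -> \near x, f x = g x.
  by move=> Ux; near do apply: fg; exact: open_nbhs_nbhs.
move=> [df Df]; split=> [x Ux|v].
  by have [] := near_eq_diff (nfg x Ux) (df x Ux).
apply: (IH (fun x => 'D_v f x)) => // x Ux.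
exact/near_eq_derive/nfg.
Unshelve. all: by end_near. Qed.

Lemma CkS (V W : normedModType R) k (U : set V) (f : V -> W) :
  Ck k.+1 U f -> Ck k U f.
Proof.
elim: k f => [|k IH] f; first by move=> [df _] x /df; apply: differentiable_continuous.
move=> [df Df]; split=> // v; exact: IH (Df v).
Qed.

Lemma Ck_cst (V W : normedModType R) k (U : set V) (a : W) : Ck k U (cst a : V -> W).
Proof.
elim: k a => [|k IH] a /=; first by move=> x _; exact: cvg_cst.
split=> [x _|v]; first exact: differentiable_cst.
rewrite (_ : (fun _ => _) = cst 0) //.
by apply/funext => x; exact: derive_cst.
Qed.

Lemma CkD (V W : normedModType R) k (U : set V) (f g : V -> W) : open U ->
  Ck k U f -> Ck k U g -> Ck k U (fun x => f x + g x).
Proof.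
move=> oU; elim: k f g => [|k IH] f g /=.
  by move=> Hf Hg x Ux; apply: cvgD; [exact: Hf|exact: Hg].
move=> [df Df] [dg Dg]; split=> [x Ux|v].
  by apply: differentiableD; [exact: df|exact: dg].
apply: Ck_ext oU _ (IH _ _ (Df v) (Dg v)) => x Ux.
by rewrite deriveD//; apply: diff_derivable; [exact: df|exact: dg].
Qed.

(** The Leibniz rule multiplies a derivative of one factor by the other factor undifferentiated, so
    the induction lowers the order of the latter with [CkS]. *)
Lemma CkM (V : normedModType R) k (U : set V) (f g : V -> R) : open U ->
  Ck k U f -> Ck k U g -> Ck k U (fun x => f x * g x).
Proof.
move=> oU; elim: k f g => [|k IH] f g.
  by move=> Hf Hg x Ux; apply: cvgM; [exact: Hf|exact: Hg].
move=> Hf Hg; have [df Df] := Hf; have [dg Dg] := Hg; split=> [x Ux|v].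
  by apply: differentiableM; [exact: df|exact: dg].
have := CkD oU (IH _ _ (CkS Hf) (Dg v)) (IH _ _ (CkS Hg) (Df v)).
apply: Ck_ext oU _ => x Ux.
by rewrite deriveM//; apply: diff_derivable; [exact: df|exact: dg].
Qed.

Lemma Ck_sum (V : normedModType R) k (U : set V) (I : Type) (r : seq I)
  (W : normedModType R) (f : I -> V -> W) : open U ->
  (forall i, Ck k U (f i)) -> Ck k U (fun x => \sum_(i <- r) f i x).
Proof.
move=> oU Hf; elim: r => [|i r IH].
  by rewrite (_ : (fun _ => _) = cst 0);
    [exact: Ck_cst | apply/funext => x; rewrite big_nil].
rewrite (_ : (fun _ => _) = (fun x => f i x + \sum_(i <- r) f i x)).
  exact: CkD.
by apply/funext => x; rewrite big_cons.
Qed.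

Lemma differentiable_rowP n (V : normedModType R) (f : V -> 'rV[R]_n) x :
  differentiable f x <-> forall i, differentiable (fun y => f y 0 i) x.
Proof.
split=> [df i|df].
  exact: (@differentiable_comp _ _ _ _ f (fun N : 'rV[R]_n => N 0 i : R)
    _ df (differentiable_coord _ _ _)).
rewrite (_ : f = \sum_(i < n) (fun y => f y 0 i *: delta_mx 0 i)).
  by apply: differentiable_sum => i; apply: differentiableZl.
by apply/funext => y; rewrite fct_sumE [LHS]row_sum_delta.
Qed.

Lemma derive_row n (V : normedModType R) (f : V -> 'rV[R]_n) x v i :
  differentiable f x -> ('D_v f x) 0 i = 'D_v (fun y => f y 0 i) x.
Proof. by move=> df; rewrite derive_mx ?mxE//; exact: diff_derivable. Qed.

Lemma Ck_rowP n (V : normedModType R) k (U : set V) (f : V -> 'rV[R]_n) : open U ->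
  Ck k U f <-> forall i, Ck k U (fun y => f y 0 i : R).
Proof.
move=> oU; elim: k f => [|k IH] f.
  split=> [Hf i x Ux|Hf].
    apply: (@continuous_comp _ _ _ f (fun N : 'rV[R]_n => N 0 i : R)).
      exact: Hf.
    exact: coord_continuous.
  rewrite (_ : f = fun y => \sum_(i < n) (f y 0 i *: delta_mx 0 i)); last first.
    by apply/funext => y; rewrite [LHS]row_sum_delta.
  apply: (@Ck_sum V 0) => // i x Ux; apply: cvgZr_tmp; exact: Hf.
split=> [[df Df] i|Hf].
  split=> [x Ux|v]; first exact: (differentiable_rowP _ _).1 (df x Ux) i.
  apply: Ck_ext oU _ ((IH _).1 (Df v) i) => x Ux.
  by rewrite derive_row//; exact: df.
have df x : U x -> differentiable f x.
  by move=> Ux; apply/differentiable_rowP => i; have [H _] := Hf i; exact: H.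
split=> // v; apply/IH => i; have [_ /(_ v)] := Hf i.
by apply: Ck_ext oU _ => x Ux; rewrite derive_row//; exact: df.
Qed.

Lemma diff_rV_sum n (f : 'rV[R]_n -> R) x v : differentiable f x ->
  'd f x v = \sum_(i < n) v 0 i * 'D_(delta_mx 0 i) f x.
Proof.
move=> df; rewrite [v in LHS]row_sum_delta linear_sum /=.
by apply: eq_bigr => i _; rewrite linearZ /= deriveE.
Qed.

(** The chain rule differentiates [f] in a direction that varies with the point, while [Ck] speaks
    of fixed directions. Expanding the direction in the standard basis gives a sum of products to
    which the induction hypothesis applies. *)
Lemma Ck_comp1 n (V : normedModType R) k (U : set V) (U' : set 'rV[R]_n)
  (g : V -> 'rV[R]_n) (f : 'rV[R]_n -> R) : open U ->
  (forall x, U x -> U' (g x)) -> Ck k U g -> Ck k U' f ->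
  Ck k U (fun x => f (g x)).
Proof.
move=> oU gU; elim: k f => [|k IH] f.
  move=> Hg Hf x Ux; apply: continuous_comp; first exact: Hg.
  exact: Hf (gU _ Ux).
move=> Hg Hf; have [dg Dg] := Hg; have [df Df] := Hf; split=> [x Ux|v].
  by apply: differentiable_comp; [exact: dg|apply: df; exact: gU].
have : Ck k U (fun x => \sum_(i < n) ('D_v g x) 0 i * 'D_(delta_mx 0 i) f (g x)).
  apply: Ck_sum => // i; apply: CkM => //.
    exact: ((Ck_rowP _ _ oU).1 (Dg v) i).
  exact: (IH _ (CkS Hg) (Df _)).
apply: Ck_ext oU _ => x Ux.
have dgx := dg _ Ux; have dfx := df _ (gU _ Ux).
rewrite [RHS]deriveE; last exact: differentiable_comp.
rewrite (diff_comp dgx dfx) /= diff_rV_sum//.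
by apply: eq_bigr => i _; rewrite deriveE.
Qed.

Lemma Ck_comp n m (V : normedModType R) k (U : set V) (U' : set 'rV[R]_n)
  (g : V -> 'rV[R]_n) (f : 'rV[R]_n -> 'rV[R]_m) : open U -> open U' ->
  (forall x, U x -> U' (g x)) -> Ck k U g -> Ck k U' f ->
  Ck k U (fun x => f (g x)).
Proof.
move=> oU oU' gU Hg Hf; apply/Ck_rowP => // i.
exact: (Ck_comp1 oU gU Hg ((Ck_rowP _ _ oU').1 Hf i)).
Qed.

End Ck_theory.

(** * Calculus on a manifold *)

Lemma diff_comp_at (R : realType) (V1 V2 V3 : normedModType R) (f : V1 -> V2)
  (g : V2 -> V3) x y v : differentiable f x -> f x = y -> differentiable g y ->
  'd (g \o f) x v = 'd g y ('d f x v).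
Proof. by move=> df fxy; rewrite -fxy => dg; rewrite diff_comp. Qed.

Section manifold_calculus.
Variables (R : realType) (n : nat) (M : manifold R n).
Implicit Types (P Q : M) (c d e : chart R n M) (U V : set M).

Lemma chart_imageE c U :
  cmap c @` (U `&` cdom c) = [set q | cimg c q /\ U (cinv c q)].
Proof.
apply/seteqP; split=> [_ [P [UP cP] <-]|q [cq Uq]] /=.
  by split; [exact: cmap_img|rewrite cmapK].
by exists (cinv c q); [split=> //; exact: cinv_dom|rewrite cinvK].
Qed.

Lemma open_chart_image c U : open U -> open (cmap c @` (U `&` cdom c)).
Proof.
move=> oU; rewrite chart_imageE openE => q [cq Uq].
have H1 : nbhs q (cimg c) by apply: open_nbhs_nbhs; split; [exact: cimg_open|].
have H2 : nbhs q (cinv c @^-1` U).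
  by apply: (cinv_continuous cq); apply: open_nbhs_nbhs.
by apply: filterS2 H1 H2 => p; split.
Qed.

Lemma cinv_near c P (A : set M) : cdom c P -> nbhs P A ->
  \forall q \near cmap c P, A (cinv c q).
Proof.
move=> cP AP; apply: (cinv_continuous (cmap_img cP)).
by rewrite cmapK.
Qed.

Arguments open_chart_image c {U} _.

Lemma chart_at_atlas P : atlas (chart_at P).
Proof. by rewrite /chart_at; case: cid => c []. Qed.

Lemma chart_at_dom P : cdom (chart_at P) P.
Proof. by rewrite /chart_at; case: cid => c []. Qed.

Lemma transition_smooth c d : atlas c -> atlas d ->
  smooth (cmap c @` (cdom c `&` cdom d)) (cmap d \o cinv c).
Proof. exact: atlas_compatible. Qed.

Lemma open_transition c d : open (cmap c @` (cdom c `&` cdom d)).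
Proof. by rewrite setIC; apply: open_chart_image; exact: cdom_open. Qed.

Lemma transition_diff c d P : atlas c -> atlas d -> cdom c P -> cdom d P ->
  differentiable (cmap d \o cinv c) (cmap c P).
Proof.
move=> Ac Ad cP dP; have [H _] := transition_smooth Ac Ad 1.
by apply: H; exists P.
Qed.

(** This cocycle rule is what makes [cvec_fun] a tangent vector. The composite through [d] agrees
    with the direct transition only where [d] is defined, hence the passage through germs. *)
Lemma transition_diff_comp c d e P v : atlas c -> atlas d -> atlas e ->
  cdom c P -> cdom d P -> cdom e P ->
  'd (cmap e \o cinv c) (cmap c P) v =
  'd (cmap e \o cinv d) (cmap d P) ('d (cmap d \o cinv c) (cmap c P) v).
Proof.
move=> Ac Ad Ae cP dP eP.
have H1 := transition_diff Ac Ad cP dP.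
have H2 := transition_diff Ad Ae dP eP.
have E : (cmap d \o cinv c) (cmap c P) = cmap d P by rewrite /= cmapK.
rewrite -E in H2.
have nE : \forall q \near cmap c P, (cmap e \o cinv d) ((cmap d \o cinv c) q) =
   (cmap e \o cinv c) q.
  have := cinv_near cP (open_nbhs_nbhs (conj (@cdom_open _ _ _ d) dP)).
  by apply: filterS => q dq /=; rewrite cmapK.
have [_ E2] := @near_eq_diff _ _ _ ((cmap e \o cinv d) \o (cmap d \o cinv c))
  (cmap e \o cinv c) _ nE (differentiable_comp H1 H2).
etransitivity; first exact: (E2 v).
apply: diff_comp_at => //; exact: transition_diff.
Qed.

Lemma transition_diff_id c P v : cdom c P ->
  'd (cmap c \o cinv c) (cmap c P) v = v.
Proof.
move=> cP.
have nE : \forall q \near cmap c P, id q = (cmap c \o cinv c) q.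
  have : nbhs (cmap c P) (cimg c).
    by apply: open_nbhs_nbhs; split; [exact: cimg_open|exact: cmap_img].
  by apply: filterS => q cq /=; rewrite cinvK.
have di : differentiable (id : 'rV[R]_n -> 'rV[R]_n) (cmap c P) by exact: ex_diff.
have [_ E] := near_eq_diff nE di.
by etransitivity; [exact: (E v)|rewrite diff_val].
Qed.

Lemma tcoordD P (u v : tangent P) : tcoord (u + v) = tcoord u + tcoord v.
Proof. exact: (raddfD (val : tangent P -> _)). Qed.

Lemma tcoordZ P a (v : tangent P) : tcoord (a *: v) = a *: tcoord v.
Proof. exact: (linearZ_LR (val : tangent P -> _)). Qed.

Lemma tcoord0 P : tcoord (0 : tangent P) = 0.
Proof. exact: (raddf0 (val : tangent P -> _)). Qed.

Lemma tcoord_transition P (v : tangent P) c d : atlas c -> cdom c P ->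
  atlas d -> cdom d P ->
  tcoord v d = 'd (cmap d \o cinv c) (cmap c P) (tcoord v c).
Proof. by move=> *; have /asboolP[_] := tcoordP v; apply. Qed.

Lemma tangent_eq c P (u v : tangent P) : atlas c -> cdom c P ->
  tcoord u c = tcoord v c -> u = v.
Proof.
move=> Ac cP E; apply: val_inj; apply/funext => d /=.
have [[Ad dP]|nd] := pselect (atlas d /\ cdom d P).
  by rewrite !(tcoord_transition _ Ac cP Ad dP) E.
have /asboolP[Hu _] := tcoordP u; have /asboolP[Hv _] := tcoordP v.
by rewrite Hu// Hv.
Qed.

Definition cvec_fun c P (v : 'rV[R]_n) : chart R n M -> 'rV[R]_n :=
  fun d => if `[< atlas d /\ cdom d P >]
           then 'd (cmap d \o cinv c) (cmap c P) v else 0.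

Lemma cvec_subproof c P v : atlas c -> cdom c P ->
  cvec_fun c P v \in is_tangent P.
Proof.
move=> Ac cP; apply/asboolP; split=> [d nd|d e Ad dP Ae eP].
  by rewrite /cvec_fun asboolF.
by rewrite /cvec_fun !asboolT//; exact: transition_diff_comp.
Qed.

(* The zero vector if c is not a chart of the atlas around P. *)
Definition cvec c P (v : 'rV[R]_n) : tangent P := insubd 0 (cvec_fun c P v).

Lemma tcoord_cvec c d P v : atlas c -> cdom c P -> atlas d -> cdom d P ->
  tcoord (cvec c P v) d = 'd (cmap d \o cinv c) (cmap c P) v.
Proof.
move=> Ac cP Ad dP.
rewrite (_ : tcoord _ = cvec_fun c P v) /cvec_fun; first by rewrite asboolT.
exact: (insubdK (0 : tangent P) (cvec_subproof v Ac cP)).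
Qed.

Lemma tcoord_cvec_id c P v : atlas c -> cdom c P -> tcoord (cvec c P v) c = v.
Proof. by move=> Ac cP; rewrite tcoord_cvec// transition_diff_id. Qed.

Lemma cvecK c P (w : tangent P) : atlas c -> cdom c P ->
  cvec c P (tcoord w c) = w.
Proof. by move=> Ac cP; apply: (tangent_eq Ac cP); rewrite tcoord_cvec_id. Qed.

Lemma tangent_sum_cvec c P (w : tangent P) : atlas c -> cdom c P ->
  w = \sum_(i < n) tcoord w c 0 i *: cvec c P (delta_mx 0 i).
Proof.
move=> Ac cP; apply: (tangent_eq Ac cP).
have -> : forall (I : Type) (r : seq I) (F : I -> tangent P),
    tcoord (\sum_(i <- r) F i) c = \sum_(i <- r) tcoord (F i) c.
  move=> I r F; elim: r => [|i r IH]; first by rewrite !big_nil tcoord0.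
  by rewrite !big_cons tcoordD fctE IH.
rewrite [LHS]row_sum_delta; apply: eq_bigr => i _.
by rewrite tcoordZ fctE tcoord_cvec_id.
Qed.

Lemma smooth_fun_ext U (f g : M -> R) : open U -> (forall P, U P -> f P = g P) ->
  smooth_fun U f -> smooth_fun U g.
Proof.
move=> oU fg Hf c Ac k; apply: Ck_ext (open_chart_image c oU) _ (Hf c Ac k).
by rewrite chart_imageE => q [cq Uq] /=; exact: fg.
Qed.

Lemma smooth_fun_cst U (a : R) : smooth_fun U (fun _ => a).
Proof. by move=> c Ac k; exact: Ck_cst. Qed.

Lemma smooth_funD U (f g : M -> R) : open U -> smooth_fun U f -> smooth_fun U g ->
  smooth_fun U (fun P => f P + g P).
Proof.
by move=> oU Hf Hg c Ac k; apply: CkD (open_chart_image c oU) (Hf c Ac k) (Hg c Ac k).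
Qed.

Lemma smooth_funM U (f g : M -> R) : open U -> smooth_fun U f -> smooth_fun U g ->
  smooth_fun U (fun P => f P * g P).
Proof.
by move=> oU Hf Hg c Ac k; apply: CkM (open_chart_image c oU) (Hf c Ac k) (Hg c Ac k).
Qed.

Lemma smooth_field_ext U (X Y : vfield M) : open U ->
  (forall P, U P -> X P = Y P) -> smooth_field U X -> smooth_field U Y.
Proof.
move=> oU XY HX c Ac k; apply: Ck_ext (open_chart_image c oU) _ (HX c Ac k).
by rewrite chart_imageE => q [cq Uq] /=; rewrite XY.
Qed.

Lemma smooth_field0 U : smooth_field U (fun P => 0 : tangent P).
Proof.
move=> c Ac k; rewrite (_ : (fun _ => _) = cst 0); first exact: Ck_cst.
by apply/funext => q; rewrite tcoord0.
Qed.

Lemma smooth_fieldD U (X Y : vfield M) : open U ->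
  smooth_field U X -> smooth_field U Y -> smooth_field U (fun P => X P + Y P).
Proof.
move=> oU HX HY c Ac k.
have := CkD (open_chart_image c oU) (HX c Ac k) (HY c Ac k).
by apply: Ck_ext (open_chart_image c oU) _ => q _; rewrite tcoordD.
Qed.

Lemma smooth_fieldZ U (f : M -> R) (X : vfield M) : open U ->
  smooth_fun U f -> smooth_field U X -> smooth_field U (fun P => f P *: X P).
Proof.
move=> oU Hf HX c Ac k; have oI := open_chart_image c oU.
apply/Ck_rowP => // i.
have := CkM oI (Hf c Ac k) ((Ck_rowP _ _ oI).1 (HX c Ac k) i).
by apply: Ck_ext oI _ => q _; rewrite tcoordZ fctE mxE.
Qed.

Lemma smooth_field_cvec c v : atlas c ->
  smooth_field (cdom c) (fun P => cvec c P v).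
Proof.
move=> Ac d Ad k.
have oI := open_chart_image d (@cdom_open _ _ _ c).
have oJ := @open_transition c d.
(* The components of the field in the chart [d] are first derivatives of the transition map, so one
   more order is requested. *)
have [_ /(_ v) H1] := transition_smooth Ac Ad k.+1.
have H2 := transition_smooth Ad Ac k; rewrite setIC in H2.
have H3 : forall q, (cmap d @` (cdom c `&` cdom d)) q ->
    (cmap c @` (cdom c `&` cdom d)) ((cmap c \o cinv d) q).
  by move=> _ [P [cP dP] <-]; exists P => //=; rewrite cmapK.
have := Ck_comp oI oJ H3 H2 H1.
apply: Ck_ext oI _ => _ [P [cP dP] <-] /=.
rewrite cmapK// tcoord_cvec// deriveE//; exact: transition_diff.
Qed.

Lemma smooth_fun_tcoord c U (X : vfield M) i : open U -> atlas c ->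
  U `<=` cdom c -> smooth_field U X ->
  smooth_fun U (fun P => tcoord (X P) c 0 i).
Proof.
move=> oU Ac Uc HX d Ad k.
have oI := open_chart_image d oU.
have oJ := open_chart_image c oU.
have H2 := transition_smooth Ad Ac k.
have H2' : Ck k (cmap d @` (U `&` cdom d)) (cmap c \o cinv d).
  apply: Ck_sub H2; apply: image_subset => P [UP dP]; split=> //; exact: Uc.
have H3 : forall q, (cmap d @` (U `&` cdom d)) q ->
    (cmap c @` (U `&` cdom c)) ((cmap c \o cinv d) q).
  by move=> _ [P [cP dP] <-]; exists P => //=; [split=> //; exact: Uc|rewrite cmapK].
have := Ck_comp1 oI H3 H2' ((Ck_rowP _ _ oJ).1 (HX c Ac k) i).
apply: Ck_ext oI _ => _ [P [UP dP] <-] /=.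
by rewrite cmapK// cmapK//; exact: Uc.
Qed.

Lemma smooth_fun_cmap c i : atlas c -> smooth_fun (cdom c) (fun P => cmap c P 0 i).
Proof.
move=> Ac d Ad k; have oI := open_chart_image d (@cdom_open _ _ _ c).
have H2 := transition_smooth Ad Ac k; rewrite setIC in H2.
exact: ((Ck_rowP _ _ oI).1 H2 i).
Qed.

(** Differentiability is asked in the one chart in which [tder] is computed, which spares a proof of
    independence of the chart. *)
Definition tdiff P (f : M -> R) : Prop :=
  differentiable (f \o cinv (chart_at P) : 'rV[R]_n -> R) (cmap (chart_at P) P).

Lemma smooth_fun_tdiff U f P : U P -> smooth_fun U f -> tdiff P f.
Proof.
move=> UP /(_ _ (chart_at_atlas P) 1%N)[+ _]; apply.
by exists P => //; split=> //; exact: chart_at_dom.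
Qed.

Lemma tdiff_near P (f g : M -> R) (v : tangent P) : (\near P, f P = g P) ->
  tdiff P f -> tdiff P g /\ tder v g = tder v f.
Proof.
move=> /(cinv_near (chart_at_dom P)) fg df.
have [dg E] := near_eq_diff fg df.
by split; [exact: dg|exact: E].
Qed.

Lemma tdiff_cst P a : tdiff P (fun _ => a).
Proof. exact: differentiable_cst. Qed.

Lemma tdiffD P f g : tdiff P f -> tdiff P g -> tdiff P (fun Q => f Q + g Q).
Proof. exact: differentiableD. Qed.

Lemma tdiffM P f g : tdiff P f -> tdiff P g -> tdiff P (fun Q => f Q * g Q).
Proof. exact: differentiableM. Qed.

Lemma tdiffV P f : tdiff P f -> f P != 0 -> tdiff P (fun Q => (f Q)^-1).
Proof.
move=> df f0; apply: differentiableV => //=.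
by rewrite cmapK//; exact: chart_at_dom.
Qed.

Lemma tdiff_sum P (I : Type) (r : seq I) (f : I -> M -> R) :
  (forall i, tdiff P (f i)) -> tdiff P (fun Q => \sum_(i <- r) f i Q).
Proof.
move=> Hf; elim: r => [|i r IH].
  by under [fun _ => _]funext => Q do rewrite big_nil; exact: tdiff_cst.
by under [fun _ => _]funext => Q do rewrite big_cons; exact: tdiffD.
Qed.

Lemma tdiff_prod P (I : Type) (r : seq I) (f : I -> M -> R) :
  (forall i, tdiff P (f i)) -> tdiff P (fun Q => \prod_(i <- r) f i Q).
Proof.
move=> Hf; elim: r => [|i r IH].
  by under [fun _ => _]funext => Q do rewrite big_nil; exact: tdiff_cst.
by under [fun _ => _]funext => Q do rewrite big_cons; exact: tdiffM.
Qed.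

Lemma tder_cst P (v : tangent P) a : tder v (fun _ => a) = 0.
Proof. by rewrite /tder (_ : _ \o _ = cst a)// diff_cst. Qed.

Lemma tderD P (v : tangent P) f g : tdiff P f -> tdiff P g ->
  tder v (fun Q => f Q + g Q) = tder v f + tder v g.
Proof.
move=> df dg; exact: (congr1 (fun h => h (tcoord v (chart_at P))) (diffD df dg)).
Qed.

Lemma tderM P (v : tangent P) f g : tdiff P f -> tdiff P g ->
  tder v (fun Q => f Q * g Q) = f P * tder v g + g P * tder v f.
Proof.
move=> df dg.
have := congr1 (fun h => h (tcoord v (chart_at P))) (diffM df dg).
by rewrite /= cmapK//; exact: chart_at_dom.
Qed.

Lemma tder_sum P (v : tangent P) (I : Type) (r : seq I) (f : I -> M -> R) :
  (forall i, tdiff P (f i)) ->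
  tder v (fun Q => \sum_(i <- r) f i Q) = \sum_(i <- r) tder v (f i).
Proof.
move=> Hf; elim: r => [|i r IH].
  by under [fun _ => _]funext => Q do rewrite big_nil; rewrite tder_cst big_nil.
under [fun _ => _]funext => Q do rewrite big_cons.
by rewrite tderD// ?IH ?big_cons//; exact: tdiff_sum.
Qed.

Lemma tdiff_continuous P f : tdiff P f -> f @ P --> f P.
Proof.
move=> df.
have cP := chart_at_dom P.
have H := differentiable_continuous df.
have H2 := continuous_comp (cmap_continuous cP) H.
have E : (f \o cinv (chart_at P)) (cmap (chart_at P) P) = f P by rewrite /= cmapK.
have H3 : (f \o cinv (chart_at P)) \o cmap (chart_at P) @ P --> f P.
  by rewrite -[X in _ --> X]E; exact: H2.
apply: cvg_trans H3; apply: near_eq_cvg.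
have : nbhs P (cdom (chart_at P)) by apply: open_nbhs_nbhs; split=> //; exact: cdom_open.
by apply: filterS => Q cQ /=; rewrite cmapK.
Qed.

Lemma tder_cmap c P (v : tangent P) i : atlas c -> cdom c P ->
  tder v (fun Q => cmap c Q 0 i) = tcoord v c 0 i.
Proof.
move=> Ac cP; rewrite (tcoord_transition v (chart_at_atlas P) (chart_at_dom P) Ac cP).
have dT := transition_diff (chart_at_atlas P) Ac (chart_at_dom P) cP.
rewrite /tder -deriveE//; last exact: ((differentiable_rowP _ _).1 dT i).
by rewrite -deriveE// derive_row.
Qed.

End manifold_calculus.

(** * The Levi-Civita connection *)

Section metric_algebra.
Variables (R : realType) (n : nat) (H : almost_hermitian R n).
Implicit Types P : H.

Lemma metricDl P (x y z : tangent P) : metric (x + y) z = metric x z + metric y z.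
Proof. by rewrite -[x in LHS]scale1r metric_linear mul1r. Qed.

Lemma metric0l P (z : tangent P) : metric 0 z = 0.
Proof. by have := metricDl 0 0 z; rewrite addr0 => /eqP; rewrite -subr_eq0 opprD addNKr oppr_eq0 => /eqP. Qed.

Lemma metricZl P a (x z : tangent P) : metric (a *: x) z = a * metric x z.
Proof. by rewrite -[a *: x]addr0 metric_linear metric0l addr0. Qed.

Lemma metric0r P (z : tangent P) : metric z 0 = 0.
Proof. by rewrite Defs.metric_sym metric0l. Qed.

Lemma metric_nondeg P (x y : tangent P) :
  (forall z, metric x z = metric y z) -> x = y.
Proof.
move=> E; apply/eqP; rewrite -subr_eq0; apply/negP => /negP nz.
have := metric_posdef nz.
by rewrite metricDl -scaleN1r metricZl mulN1r E subrr ltxx.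
Qed.

End metric_algebra.

Section connection.
Variables (R : realType) (n : nat) (H : almost_hermitian R n).
Variable nabla : vfield H -> vfield H -> vfield H.
Hypothesis LC : levi_civita nabla.
Variable c : chart R n H.
Hypothesis Ac : atlas c.

Local Notation U := (cdom c).
Local Notation sf := (smooth_field (cdom c)).
Local Notation sff := (smooth_fun (cdom c)).
Let oU : open U := @cdom_open _ _ _ c.
Implicit Types (P Q : H) (X Y Z V W : vfield H).

Lemma nabla_congr X X' Y Y' P : (forall Q, X Q = X' Q) ->
  (forall Q, Y Q = Y' Q) -> nabla X Y P = nabla X' Y' P.
Proof.
move=> EX EY; rewrite (functional_extensionality_dep EX).
by rewrite (functional_extensionality_dep EY).
Qed.

Definition cfield (i : 'I_n) : vfield H := fun P => cvec c P (delta_mx 0 i).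

Lemma smooth_cfield i : sf (cfield i).
Proof. exact: smooth_field_cvec. Qed.

Lemma smooth_field_sum (I : Type) (r : seq I) (X : I -> vfield H) :
  (forall i, sf (X i)) -> sf (fun Q => \sum_(i <- r) X i Q).
Proof.
move=> sX; elim: r => [|i r IH].
  rewrite (_ : (fun _ => _) = fun Q => 0); first exact: smooth_field0.
  by apply/functional_extensionality_dep => Q; rewrite big_nil.
rewrite (_ : (fun _ => _) = fun Q => X i Q + \sum_(i <- r) X i Q).
  exact: smooth_fieldD.
by apply/functional_extensionality_dep => Q; rewrite big_cons.
Qed.

Lemma smooth_fieldN X : sf X -> sf (fun Q => - X Q).
Proof.
move=> sX; rewrite (_ : (fun _ => _) = fun Q => (-1) *: X Q).
  by apply: smooth_fieldZ => //; exact: smooth_fun_cst.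
by apply/functional_extensionality_dep => Q; rewrite scaleN1r.
Qed.

Lemma smooth_fieldB X Y : sf X -> sf Y -> sf (fun Q => X Q - Y Q).
Proof. by move=> sX sY; apply: smooth_fieldD => //; exact: smooth_fieldN. Qed.

Lemma smooth_nabla X Y : sf X -> sf Y -> sf (nabla X Y).
Proof. exact: (nabla_smooth LC). Qed.

(* Multiplication by the indicator function of U, which is smooth on U, turns
   fields that agree on U into equal fields. *)
Lemma nabla_local X X' Y Y' P : sf X -> sf Y -> (forall Q, U Q -> X Q = X' Q) ->
  (forall Q, U Q -> Y Q = Y' Q) -> U P -> nabla X Y P = nabla X' Y' P.
Proof.
move=> sX sY EX EY UP.
have sX' := smooth_field_ext oU EX sX.
have sY' := smooth_field_ext oU EY sY.
pose f Q : R := if `[< U Q >] then 1 else 0.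
have f1 Q : U Q -> f Q = 1 by move=> UQ; rewrite /f asboolT.
have sF : sff f.
  by apply: smooth_fun_ext oU _ (@smooth_fun_cst _ _ H U 1) => Q UQ; rewrite f1.
have E Z Z' : (forall Q, U Q -> Z Q = Z' Q) ->
    (fun Q => f Q *: Z Q) = (fun Q => f Q *: Z' Q).
  move=> ZZ; apply/functional_extensionality_dep => Q; rewrite /f.
  by case: asboolP => [/ZZ ->//|_]; rewrite !scale0r.
transitivity (nabla X' Y P).
  have := nabla_scalel LC oU sF sX sY UP; rewrite (E _ _ EX).
  by rewrite (nabla_scalel LC oU sF sX' sY UP) f1// !scale1r => ->.
have := nabla_leibniz LC oU sF sX' sY UP; rewrite (E _ _ EY).
rewrite (nabla_leibniz LC oU sF sX' sY' UP) f1// !scale1r EY//.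
by move=> /addrI ->.
Qed.

Lemma nabla0l Y P : sf Y -> U P -> nabla (fun Q => 0) Y P = 0.
Proof.
move=> sY UP.
have := nabla_scalel LC oU (@smooth_fun_cst _ _ H U 0) (@smooth_field0 _ _ H U) sY UP.
rewrite scale0r => <-.
by apply: nabla_congr => // Q; rewrite scale0r.
Qed.

Lemma nabla0r Y P : sf Y -> U P -> nabla Y (fun Q => 0) P = 0.
Proof.
move=> sY UP.
have := nabla_leibniz LC oU (@smooth_fun_cst _ _ H U 0) sY (@smooth_field0 _ _ H U) UP.
rewrite scale0r scaler0 addr0 => <-.
by apply: nabla_congr => // Q; rewrite scale0r.
Qed.

Lemma nablaZr a X Y P : sf X -> sf Y -> U P ->
  nabla X (fun Q => a *: Y Q) P = a *: nabla X Y P.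
Proof.
move=> sX sY UP.
rewrite (nabla_leibniz LC oU (@smooth_fun_cst _ _ H U a) sX sY UP).
by rewrite /fder tder_cst scale0r add0r.
Qed.

Lemma nablaNr X Y P : sf X -> sf Y -> U P ->
  nabla X (fun Q => - Y Q) P = - nabla X Y P.
Proof.
move=> sX sY UP; rewrite -scaleN1r -nablaZr//.
by apply: nabla_congr => // Q; rewrite scaleN1r.
Qed.

Lemma nablaDr X Y Z P : sf X -> sf Y -> sf Z -> U P ->
  nabla X (fun Q => Y Q + Z Q) P = nabla X Y P + nabla X Z P.
Proof. by move=> *; apply: (nabla_addr LC oU). Qed.

Lemma nablaBr X Y Z P : sf X -> sf Y -> sf Z -> U P ->
  nabla X (fun Q => Y Q - Z Q) P = nabla X Y P - nabla X Z P.
Proof.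
by move=> sX sY sZ UP; rewrite nablaDr ?nablaNr//; exact: smooth_fieldN.
Qed.

Lemma nabla_suml (I : Type) (r : seq I) (f : I -> H -> R) (X : I -> vfield H) Y P :
  (forall i, sff (f i)) -> (forall i, sf (X i)) -> sf Y -> U P ->
  nabla (fun Q => \sum_(i <- r) f i Q *: X i Q) Y P =
  \sum_(i <- r) f i P *: nabla (X i) Y P.
Proof.
move=> sF sX sY UP; have sFX i : sf (fun Q => f i Q *: X i Q) by exact: smooth_fieldZ.
elim: r => [|i r IH].
  rewrite big_nil -(nabla0l sY UP).
  by apply: nabla_congr => // Q; rewrite big_nil.
rewrite big_cons -IH -(nabla_scalel LC oU (sF i) (sX i) sY UP).
rewrite -(nabla_addl LC oU _ _ sY UP)//; last exact: smooth_field_sum.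
by apply: nabla_congr => // Q; rewrite big_cons.
Qed.

Lemma nabla_sumr (I : Type) (r : seq I) (f : I -> H -> R) (X : I -> vfield H) Y P :
  (forall i, sff (f i)) -> (forall i, sf (X i)) -> sf Y -> U P ->
  nabla Y (fun Q => \sum_(i <- r) f i Q *: X i Q) P =
  \sum_(i <- r) (tder (Y P) (f i) *: X i P + f i P *: nabla Y (X i) P).
Proof.
move=> sF sX sY UP; have sFX i : sf (fun Q => f i Q *: X i Q) by exact: smooth_fieldZ.
elim: r => [|i r IH].
  rewrite big_nil -(nabla0r sY UP).
  by apply: nabla_congr => // Q; rewrite big_nil.
rewrite big_cons -IH -(nabla_leibniz LC oU (sF i) sY (sX i) UP).
rewrite -nablaDr//; last exact: smooth_field_sum.
by apply: nabla_congr => // Q; rewrite big_cons.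
Qed.

Lemma cfield_expansion X P : U P ->
  X P = \sum_(i < n) tcoord (X P) c 0 i *: cfield i P.
Proof. by move=> UP; exact: tangent_sum_cvec. Qed.

Lemma smooth_coord X i : sf X -> sff (fun P => tcoord (X P) c 0 i).
Proof. by move=> sX; exact: smooth_fun_tcoord. Qed.

Lemma nabla_expansion X Y P : sf X -> sf Y -> U P ->
  nabla X Y P = \sum_(i < n) tcoord (X P) c 0 i *: nabla (cfield i) Y P.
Proof.
move=> sX sY UP.
rewrite -(@nabla_suml _ _ (fun i P => tcoord (X P) c 0 i))//.
- by apply: nabla_local => // Q UQ; exact: cfield_expansion.
- by move=> i; exact: smooth_coord.
- exact: smooth_cfield.
Qed.

Lemma nabla_eql X X' Y P : sf X -> sf X' -> sf Y -> U P -> X P = X' P ->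
  nabla X Y P = nabla X' Y P.
Proof. by move=> *; rewrite !(@nabla_expansion _ Y)//; apply: eq_bigr => i _; congr (tcoord _ _ _ _ *: _). Qed.

Lemma lie_bracketE X Y P : sf X -> sf Y -> U P ->
  lie_bracket X Y P = nabla X Y P - nabla Y X P.
Proof. by move=> *; rewrite (nabla_torsion_free LC oU). Qed.

Lemma smooth_lie_bracket X Y : sf X -> sf Y -> sf (lie_bracket X Y).
Proof.
move=> sX sY.
apply: smooth_field_ext oU _ (smooth_fieldB (smooth_nabla sX sY) (smooth_nabla sY sX)).
by move=> Q UQ; rewrite lie_bracketE.
Qed.

Lemma smooth_curvature_op X Y Z : sf X -> sf Y -> sf Z ->
  sf (curvature_op nabla X Y Z).
Proof.
move=> sX sY sZ; apply: smooth_fieldB; last by apply: smooth_nabla => //; exact: smooth_lie_bracket.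
by apply: smooth_fieldB; do !apply: smooth_nabla.
Qed.

(** A first-order substitute for parallel fields: frames of such fields play the part of normal
    coordinates centred at [P]. *)
Definition normal_at P X := forall V, sf V -> nabla V X P = 0.

Lemma exists_normal_field P X : sf X -> U P ->
  exists Y, [/\ sf Y, Y P = X P & normal_at P Y].
Proof.
move=> sX UP.
pose f i Q : R := cmap c P 0 i + (-1) * cmap c Q 0 i.
have sx i : sff (fun Q => (-1) * cmap c Q 0 i).
  by apply: smooth_funM oU _ _; [exact: smooth_fun_cst|exact: smooth_fun_cmap].
have sF i : sff (f i).
  by apply: smooth_funD oU _ _; [exact: smooth_fun_cst|].
have f0 i : f i P = 0 by rewrite /f mulN1r subrr.
have sN i : sf (nabla (cfield i) X) by apply: smooth_nabla => //; exact: smooth_cfield.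
have sS : sf (fun Q => \sum_(i < n) f i Q *: nabla (cfield i) X Q).
  by apply: smooth_field_sum => i; exact: smooth_fieldZ.
(* Subtract the first-order part of X, in coordinates centred at P. *)
exists (fun Q => X Q + \sum_(i < n) f i Q *: nabla (cfield i) X Q); split.
- exact: smooth_fieldD.
- by rewrite big1 ?addr0// => i _; rewrite f0 scale0r.
move=> V sV; rewrite nablaDr// nabla_sumr//.
(* Each [f i] vanishes at [P], and its derivative along [V] is minus the [i]-th coordinate of [V];
   the correction is therefore the opposite of this expansion, term by term. *)
rewrite (nabla_expansion sV sX UP) -big_split big1//= => i _.
rewrite f0 scale0r addr0 -scalerDl.
rewrite tderD; [|exact: tdiff_cst|exact: smooth_fun_tdiff UP (sx i)].
rewrite tderM; [|exact: tdiff_cst|exact: smooth_fun_tdiff UP (smooth_fun_cmap i Ac)].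
rewrite !tder_cst tder_cmap// mulr0 addr0 add0r mulN1r.
by rewrite subrr scale0r.
Qed.

(* D X is (nabla_V L) X, for a field L of endomorphisms. *)
Lemma defect_linear (L : forall Q, tangent Q -> tangent Q) V X X' f P :
  (forall Q, U Q -> forall a x y, L Q (a *: x + y) = a *: L Q x + L Q y) ->
  (forall X, sf X -> sf (fun Q => L Q (X Q))) ->
  sf V -> sf X -> sf X' -> sff f -> U P ->
  let D X := nabla V (fun Q => L Q (X Q)) P - L P (nabla V X P) in
  D (fun Q => f Q *: X Q + X' Q) = f P *: D X + D X'.
Proof.
move=> hL sL sV sX sX' sF UP /=.
have sfX : sf (fun Q => f Q *: X Q) by exact: smooth_fieldZ.
have sLX := sL _ sX; have sLX' := sL _ sX'.
have sfL : sf (fun Q => f Q *: L Q (X Q)) by exact: smooth_fieldZ.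
rewrite (@nabla_local V V _ (fun Q => f Q *: L Q (X Q) + L Q (X' Q)))//; first last.
- by move=> Q UQ; rewrite hL.
- by apply: sL; exact: smooth_fieldD.
rewrite !nablaDr// !(nabla_leibniz LC oU sF)//.
rewrite -[_ *: X P + _ + _]addrA !hL// scalerBr !opprD.
by rewrite -[_ *: L P (X P) + _ + _]addrA addrACA subrr add0r addrACA.
Qed.

(** Linearity over functions implies dependence on the value at [P] alone: [X - X'] is a combination
    of coordinate fields whose coefficients vanish at [P], and each summand changes the defect by
    its coefficient times another defect. The partial sums [Y r] add the summands one at a time. *)
Lemma defect_eq (L : forall Q, tangent Q -> tangent Q) V X X' P :
  (forall Q, U Q -> forall a x y, L Q (a *: x + y) = a *: L Q x + L Q y) ->
  (forall X, sf X -> sf (fun Q => L Q (X Q))) ->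
  sf V -> sf X -> sf X' -> U P -> X P = X' P ->
  nabla V (fun Q => L Q (X Q)) P - L P (nabla V X P) =
  nabla V (fun Q => L Q (X' Q)) P - L P (nabla V X' P).
Proof.
move=> hL sL sV sX sX' UP XX'.
pose g i Q : R := tcoord (X Q - X' Q) c 0 i.
have sg i : sff (g i) by apply: smooth_coord; exact: smooth_fieldB.
have g0 i : g i P = 0 by rewrite /g XX' subrr tcoord0 /= mxE.
pose Y (r : seq 'I_n) Q := \sum_(i <- r) g i Q *: cfield i Q + X' Q.
have sS r : sf (fun Q => \sum_(i <- r) g i Q *: cfield i Q).
  by apply: smooth_field_sum => i; apply: smooth_fieldZ => //; exact: smooth_cfield.
have sY r : sf (Y r) by apply: smooth_fieldD.
have XY Q : U Q -> X Q = Y (index_enum 'I_n) Q.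
  move=> UQ; apply: (addIr (- X' Q)); rewrite /Y addrK.
  exact: (cfield_expansion (fun Q => X Q - X' Q) UQ).
rewrite (@nabla_local V V _ (fun Q => L Q (Y (index_enum 'I_n) Q)))//; first last.
- by move=> Q UQ; rewrite XY.
- exact: sL.
rewrite (@nabla_local V V X (Y (index_enum 'I_n)))//.
elim: (index_enum _) => [|i r IH].
  have -> : Y [::] = X'; last by [].
  by apply/functional_extensionality_dep => Q; rewrite /Y big_nil add0r.
have E : Y (i :: r) = fun Q => g i Q *: cfield i Q + Y r Q.
  by apply/functional_extensionality_dep => Q; rewrite /Y big_cons addrA.
rewrite E (defect_linear hL sL sV (smooth_cfield i) (sY r) (sg i) UP).
by rewrite g0 scale0r add0r.
Qed.

End connection.

(** * Curvature and its covariant derivative *)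

(** In the commutator of two derivatives of R(x, y)z, the indexed letters carry both derivatives, or
    the bracket, on a single argument. The letters [p] to [m] put one derivative on each of two
    arguments and occur with both signs. Testing with an additive [f] into a commutative ring turns
    the cancellation into a ring identity. *)
Lemma cross_terms_additive (R : comNzRingType) (V : zmodType) (f : V -> R)
    (a1 a2 a3 b1 b2 b3 c1 c2 c3 p q r s t m : V) :
  (forall a b, f (a + b) = f a + f b) -> (forall a, f (- a) = - f a) ->
  f (a1 + p + q + (r + a2 + s) + (t + m + a3)
     - (b1 + r + t + (p + b2 + m) + (q + s + b3)) - (c1 + c2 + c3)) =
  f (a1 - b1 - c1 + (a2 - b2 - c2) + (a3 - b3 - c3)).
Proof. by move=> fD fN; rewrite !(fN, fD); ring. Qed.

Section curvature.
Variables (R : realType) (n : nat) (H : almost_hermitian R n).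
Variable nabla : vfield H -> vfield H -> vfield H.
Hypothesis LC : levi_civita nabla.
Variable Rm : forall P : H, tangent P -> tangent P -> tangent P -> tangent P -> R.
Hypothesis CT : @curvature_tensor R n H nabla Rm.
Hypothesis Rm_lin1 : forall P a x x' y z w,
  @Rm P (a *: x + x') y z w = a * Rm x y z w + Rm x' y z w.
Hypothesis Rm_lin2 : forall P a x x' y z w,
  @Rm P y (a *: x + x') z w = a * Rm y x z w + Rm y x' z w.
Hypothesis Rm_lin3 : forall P a x x' y z w,
  @Rm P y z (a *: x + x') w = a * Rm y z x w + Rm y z x' w.
Variable c : chart R n H.
Hypothesis Ac : atlas c.

Local Notation U := (cdom c).
Local Notation sf := (smooth_field (cdom c)).
Local Notation sff := (smooth_fun (cdom c)).
Let oU : open U := @cdom_open _ _ _ c.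
Implicit Types (P Q : H) (X Y Z V W : vfield H).

Definition extend P (x : tangent P) : vfield H := fun Q => cvec c Q (tcoord x c).

Lemma smooth_extend P (x : tangent P) : sf (extend x).
Proof. exact: smooth_field_cvec. Qed.

Lemma extendE P (x : tangent P) : U P -> extend x P = x.
Proof. by move=> UP; rewrite /extend cvecK. Qed.

Definition Rop P (x y z : tangent P) : tangent P :=
  curvature_op nabla (extend x) (extend y) (extend z) P.

Lemma metric_Rop P (x y z w : tangent P) : U P ->
  metric (Rop x y z) w = Rm x y z w.
Proof.
move=> UP; have := CT oU (smooth_extend x) (smooth_extend y) (smooth_extend z)
  (smooth_extend w) UP.
by rewrite !extendE// => ->.
Qed.

(** Tensoriality is not recomputed from the connection: [CT] already expresses the pairing with any
    [w] through the values at [P], and the metric is nondegenerate. *)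
Lemma curvature_opE X Y Z P : sf X -> sf Y -> sf Z -> U P ->
  curvature_op nabla X Y Z P = Rop (X P) (Y P) (Z P).
Proof.
move=> sX sY sZ UP; apply: metric_nondeg => w; rewrite metric_Rop//.
have := CT oU sX sY sZ (smooth_extend w) UP.
by rewrite extendE// => ->.
Qed.

Local Opaque Rop.

Lemma Rop_lin1 P a (x x' y z : tangent P) : U P ->
  Rop (a *: x + x') y z = a *: Rop x y z + Rop x' y z.
Proof.
move=> UP; apply: metric_nondeg => w; rewrite (metric_Rop _ _ _ _ UP) Rm_lin1.
by rewrite -(metric_Rop x y z w UP) -(metric_Rop x' y z w UP) -metric_linear.
Qed.

Lemma Rop_lin2 P a (x x' y z : tangent P) : U P ->
  Rop y (a *: x + x') z = a *: Rop y x z + Rop y x' z.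
Proof.
move=> UP; apply: metric_nondeg => w; rewrite (metric_Rop _ _ _ _ UP) Rm_lin2.
by rewrite [RHS]metric_linear !(metric_Rop _ _ _ _ UP).
Qed.

Lemma Rop_lin3 P a (x x' y z : tangent P) : U P ->
  Rop y z (a *: x + x') = a *: Rop y z x + Rop y z x'.
Proof.
move=> UP; apply: metric_nondeg => w; rewrite (metric_Rop _ _ _ _ UP) Rm_lin3.
by rewrite [RHS]metric_linear !(metric_Rop _ _ _ _ UP).
Qed.

Lemma linear_op0 P (f : tangent P -> tangent P) :
  (forall a x y, f (a *: x + y) = a *: f x + f y) -> f 0 = 0.
Proof.
move=> hf; have := hf (-1) 0 0; rewrite scaler0 addr0 => ->.
by rewrite scaleN1r addNr.
Qed.

Lemma linear_opB P (f : tangent P -> tangent P) x y :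
  (forall a x y, f (a *: x + y) = a *: f x + f y) -> f (x - y) = f x - f y.
Proof. by move=> hf; rewrite addrC -scaleN1r hf scaleN1r addrC. Qed.

Definition Rfield X Y Z : vfield H := fun Q => Rop (X Q) (Y Q) (Z Q).

Lemma smooth_Rfield X Y Z : sf X -> sf Y -> sf Z -> sf (Rfield X Y Z).
Proof.
move=> sX sY sZ.
apply: smooth_field_ext oU _ (smooth_curvature_op LC sX sY sZ) => Q UQ.
exact: curvature_opE.
Qed.

Definition nablaR V X Y Z P : tangent P :=
  nabla V (Rfield X Y Z) P - Rop (nabla V X P) (Y P) (Z P)
  - Rop (X P) (nabla V Y P) (Z P) - Rop (X P) (Y P) (nabla V Z P).

Lemma nablaR_normal V X Y Z P : U P -> sf V -> normal_at nabla c P X ->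
  normal_at nabla c P Y -> normal_at nabla c P Z ->
  nablaR V X Y Z P = nabla V (Rfield X Y Z) P.
Proof.
move=> UP sV nX nY nZ; rewrite /nablaR nX// nY// nZ//.
rewrite (@linear_op0 _ (fun x => Rop x _ _)) ?subr0; last first.
  by move=> *; exact: Rop_lin1.
rewrite (@linear_op0 _ (fun x => Rop _ x _)) ?subr0; last first.
  by move=> *; exact: Rop_lin2.
rewrite (@linear_op0 _ (fun x => Rop _ _ x)) ?subr0//.
by move=> *; exact: Rop_lin3.
Qed.

(** Linearity over constants together with dependence on the value at [P] is all that is needed to
    test vanishing on fields whose values span the tangent space at [P]. *)
Definition tensorial_at P (T : vfield H -> tangent P) :=
  (forall a X X', sf X -> sf X' ->
     T (fun Q => a *: X Q + X' Q) = a *: T X + T X') /\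
  (forall X X', sf X -> sf X' -> X P = X' P -> T X = T X').

Lemma tensorialB P (T T' : vfield H -> tangent P) :
  tensorial_at T -> tensorial_at T' -> tensorial_at (fun X => T X - T' X).
Proof.
move=> [T1 T2] [T1' T2']; split=> [a X X' sX sX'|X X' sX sX' E].
  by rewrite T1// T1'// scalerBr opprD addrACA.
by rewrite (T2 _ X')// (T2' _ X').
Qed.

Lemma tensorial_value P (f : tangent P -> tangent P) :
  (forall a x y, f (a *: x + y) = a *: f x + f y) ->
  tensorial_at (fun X => f (X P)).
Proof. by move=> hf; split=> [a X X' _ _|X X' _ _ ->]. Qed.

Lemma tensorial_defect (L : forall Q, tangent Q -> tangent Q) V P :
  (forall Q, U Q -> forall a x y, L Q (a *: x + y) = a *: L Q x + L Q y) ->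
  (forall X, sf X -> sf (fun Q => L Q (X Q))) -> sf V -> U P ->
  tensorial_at (fun X => nabla V (fun Q => L Q (X Q)) P - L P (nabla V X P)).
Proof.
move=> hL sL sV UP; split=> [a X X' sX sX'|X X' sX sX' E].
  exact: (defect_linear LC hL sL sV sX sX' (@smooth_fun_cst _ _ H U a) UP).
exact: (defect_eq LC Ac).
Qed.

Lemma tensorial_ext P (T T' : vfield H -> tangent P) :
  (forall X, T X = T' X) -> tensorial_at T -> tensorial_at T'.
Proof.
move=> E [T1 T2]; split=> [a X X' sX sX'|X X' sX sX' EX]; rewrite -!E.
  exact: T1.
exact: T2.
Qed.

Lemma nablaR_tensorialV X Y Z P : sf X -> sf Y -> sf Z -> U P ->
  tensorial_at (fun V => nablaR V X Y Z P).
Proof.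
move=> sX sY sZ UP.
have nT W : sf W -> tensorial_at (fun V => nabla V W P).
  move=> sW; split=> [a V V' sV sV'|V V' sV sV' E]; last exact: (nabla_eql LC Ac).
  rewrite (nabla_addl LC oU _ sV' sW)//; last first.
    by apply: smooth_fieldZ => //; exact: smooth_fun_cst.
  by rewrite (nabla_scalel LC oU (@smooth_fun_cst _ _ H U a)).
have fT W f : sf W -> (forall a x y, f (a *: x + y) = a *: f x + f y) ->
    tensorial_at (fun V => f (nabla V W P) : tangent P).
  move=> /nT [T1 T2] hf; split=> [a V V' sV sV'|V V' sV sV' E].
    by rewrite T1.
  by rewrite (T2 _ V').
apply: tensorialB; [apply: tensorialB; [apply: tensorialB|]|].
- by apply: nT; exact: smooth_Rfield.
- by apply: (fT _ (fun x => Rop x _ _)) => // *; exact: Rop_lin1.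
- by apply: (fT _ (fun x => Rop _ x _)) => // *; exact: Rop_lin2.
- by apply: (fT _ (fun x => Rop _ _ x)) => // *; exact: Rop_lin3.
Qed.

Lemma nablaR_tensorialX V Y Z P : sf V -> sf Y -> sf Z -> U P ->
  tensorial_at (fun X => nablaR V X Y Z P).
Proof.
move=> sV sY sZ UP.
apply: tensorialB; [apply: tensorialB|].
- apply: (@tensorial_defect (fun Q x => Rop x (Y Q) (Z Q))) => //.
    by move=> *; exact: Rop_lin1.
  by move=> X sX; exact: smooth_Rfield.
- by apply: (@tensorial_value _ (fun x => Rop x _ _)) => *; exact: Rop_lin1.
- by apply: (@tensorial_value _ (fun x => Rop x _ _)) => *; exact: Rop_lin1.
Qed.

Lemma nablaR_tensorialY V X Z P : sf V -> sf X -> sf Z -> U P ->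
  tensorial_at (fun Y => nablaR V X Y Z P).
Proof.
move=> sV sX sZ UP.
(* Reordering the terms of [nablaR] isolates one defect in [Y]; the other two terms depend on [Y P]
   through a linear map. *)
pose T1 Y := nabla V (Rfield X Y Z) P - Rop (X P) (nabla V Y P) (Z P).
pose T2 Y := T1 Y - Rop (nabla V X P) (Y P) (Z P).
apply: (@tensorial_ext _ (fun Y => T2 Y - Rop (X P) (Y P) (nabla V Z P))).
  have E (a b d e : tangent P) : a - d - b - e = a - b - d - e by rewrite (addrAC a).
  by move=> Y; exact: E.
apply: tensorialB; [apply: tensorialB|].
- apply: (@tensorial_defect (fun Q x => Rop (X Q) x (Z Q))) => //.
    by move=> *; exact: Rop_lin2.
  by move=> Y sY; exact: smooth_Rfield.
- by apply: (@tensorial_value _ (fun x => Rop _ x _)) => *; exact: Rop_lin2.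
- by apply: (@tensorial_value _ (fun x => Rop _ x _)) => *; exact: Rop_lin2.
Qed.

Lemma nablaR_tensorialZ V X Y P : sf V -> sf X -> sf Y -> U P ->
  tensorial_at (fun Z => nablaR V X Y Z P).
Proof.
move=> sV sX sY UP.
pose T1 Z := nabla V (Rfield X Y Z) P - Rop (X P) (Y P) (nabla V Z P).
pose T2 Z := T1 Z - Rop (nabla V X P) (Y P) (Z P).
apply: (@tensorial_ext _ (fun Z => T2 Z - Rop (X P) (nabla V Y P) (Z P))).
  have E (a b d e : tangent P) : a - e - b - d = a - b - d - e.
    by rewrite (addrAC a) (addrAC (a - b)).
  by move=> Z; exact: E.
apply: tensorialB; [apply: tensorialB|].
- apply: (@tensorial_defect (fun Q x => Rop (X Q) (Y Q) x)) => //.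
    by move=> *; exact: Rop_lin3.
  by move=> Z sZ; exact: smooth_Rfield.
- by apply: (@tensorial_value _ (fun x => Rop _ _ x)) => *; exact: Rop_lin3.
- by apply: (@tensorial_value _ (fun x => Rop _ _ x)) => *; exact: Rop_lin3.
Qed.

Lemma tensorial_vanish P (T : vfield H -> tangent P) m (E : 'I_m -> vfield H) :
  tensorial_at T -> (forall a, sf (E a)) ->
  (forall x : tangent P, exists xi : 'I_m -> R, x = \sum_a xi a *: E a P) ->
  (forall a, T (E a) = 0) -> forall X, sf X -> T X = 0.
Proof.
move=> [T1 T2] sE span TE X sX; have [xi Xxi] := span (X P).
have s0 := @smooth_field0 _ _ H U.
pose Y (r : seq 'I_m) Q := \sum_(a <- r) xi a *: E a Q.
have sY r : sf (Y r).
  by apply: smooth_field_sum => a; apply: smooth_fieldZ => //; exact: smooth_fun_cst.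
rewrite (T2 _ (Y (index_enum 'I_m)))//.
have T0 : T (fun Q => 0) = 0.
  have := T1 (-1) _ _ s0 s0; rewrite scaleN1r addNr => <-.
  by apply: T2 => //; [apply: smooth_fieldD => //; apply: smooth_fieldZ => //;
    exact: smooth_fun_cst|rewrite scaler0 addr0].
elim: (index_enum _) => [|a r IH].
  by rewrite -[RHS]T0; apply: T2 => //; rewrite /Y big_nil.
rewrite (T2 _ (fun Q => xi a *: E a Q + Y r Q)) ?T1 ?TE ?IH ?scaler0 ?addr0//.
  by apply: smooth_fieldD => //; apply: smooth_fieldZ => //; exact: smooth_fun_cst.
by rewrite /Y big_cons.
Qed.

Lemma nablaR_vanish P m (E : 'I_m -> vfield H) : U P -> (forall a, sf (E a)) ->
  (forall x : tangent P, exists xi : 'I_m -> R, x = \sum_a xi a *: E a P) ->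
  (forall d a b k, nablaR (E d) (E a) (E b) (E k) P = 0) ->
  forall V X Y Z, sf V -> sf X -> sf Y -> sf Z -> nablaR V X Y Z P = 0.
Proof.
move=> UP sE span HE V X Y Z sV sX sY sZ.
apply: (tensorial_vanish (nablaR_tensorialV sX sY sZ UP) sE span) => // d.
apply: (tensorial_vanish (nablaR_tensorialX (sE d) sY sZ UP) sE span) => // a.
apply: (tensorial_vanish (nablaR_tensorialY (sE d) (sE a) sZ UP) sE span) => // b.
apply: (tensorial_vanish (nablaR_tensorialZ (sE d) (sE a) (sE b) UP) sE span) => // k.
Qed.

Lemma nabla_Rfield X Y Z V P : sf X -> sf Y -> sf Z -> sf V -> U P ->
  nabla V (Rfield X Y Z) P = nabla V (nabla X (nabla Y Z)) P
    - nabla V (nabla Y (nabla X Z)) P - nabla V (nabla (lie_bracket X Y) Z) P.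
Proof.
move=> sX sY sZ sV UP.
have sB := smooth_lie_bracket LC sX sY.
have sN A B : sf A -> sf B -> sf (nabla A B) by apply: smooth_nabla.
rewrite (@nabla_local _ _ _ _ LC c V V _ (curvature_op nabla X Y Z))//; first last.
- by move=> Q UQ; rewrite curvature_opE.
- exact: smooth_Rfield.
have sXY : sf (nabla X (nabla Y Z)) by apply: (sN) => //; exact: sN.
have sYX : sf (nabla Y (nabla X Z)) by apply: (sN) => //; exact: sN.
have sBZ : sf (nabla (lie_bracket X Y) Z) by exact: sN.
rewrite (@nablaBr _ _ _ _ LC c V _ _ P sV (smooth_fieldB sXY sYX) sBZ UP).
by rewrite (@nablaBr _ _ _ _ LC c V _ _ P sV sXY sYX UP).
Qed.

Lemma normal_bracket X Y P : sf X -> sf Y -> U P -> normal_at nabla c P X ->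
  normal_at nabla c P Y -> lie_bracket X Y P = 0.
Proof. by move=> sX sY UP nX nY; rewrite (lie_bracketE LC sX sY UP) nX// nY// subrr. Qed.

Lemma nabla_zero_l X Y P : sf X -> sf Y -> U P -> X P = 0 -> nabla X Y P = 0.
Proof.
move=> sX sY UP X0; rewrite -(nabla0l LC sY UP).
by apply: (nabla_eql LC Ac) => //; exact: smooth_field0.
Qed.

Lemma Rop0_2 P (x z : tangent P) : U P -> Rop x 0 z = 0.
Proof. by move=> UP; apply: (@linear_op0 _ (fun y => Rop x y z)) => *; exact: Rop_lin2. Qed.

Lemma Rop0_3 P (x y : tangent P) : U P -> Rop x y 0 = 0.
Proof. by move=> UP; apply: (@linear_op0 _ (fun z => Rop x y z)) => *; exact: Rop_lin3. Qed.

(** The curvature term vanishes because [W] does at [P], and the bracket term because two fields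
    normal at [P] have zero bracket there. *)
Lemma nabla_comm_normal V X W P : sf V -> sf X -> sf W -> U P ->
  normal_at nabla c P X -> normal_at nabla c P V -> W P = 0 ->
  nabla V (nabla X W) P = nabla X (nabla V W) P.
Proof.
move=> sV sX sW UP nX nV W0.
have := curvature_opE sV sX sW UP; rewrite W0 Rop0_3// /curvature_op.
rewrite (@nabla_zero_l (lie_bracket V X))//; last exact: normal_bracket.
  by rewrite subr0 => /eqP; rewrite subr_eq0 => /eqP.
exact: (smooth_lie_bracket LC).
Qed.

(** The six third derivatives of [Z] cancel in pairs, since the outer two derivatives commute on
    first derivatives of [Z], which vanish at [P]. The derivatives of the bracket terms vanish one
    by one, without the Jacobi identity: [third] evaluates the curvature on [A] and a bracket that
    is zero at [P]. *)
Lemma second_bianchi V X Y Z P : sf V -> sf X -> sf Y -> sf Z -> U P ->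
  normal_at nabla c P V -> normal_at nabla c P X -> normal_at nabla c P Y ->
  normal_at nabla c P Z ->
  nabla V (Rfield X Y Z) P + nabla X (Rfield Y V Z) P + nabla Y (Rfield V X Z) P = 0.
Proof.
move=> sV sX sY sZ UP nV nX nY nZ.
have sN A B : sf A -> sf B -> sf (nabla A B) by apply: smooth_nabla.
have third A B C : sf A -> sf B -> sf C -> normal_at nabla c P A ->
    normal_at nabla c P B -> normal_at nabla c P C ->
    nabla A (nabla (lie_bracket B C) Z) P = 0.
  move=> sA sB sC nA nB nC.
  have sBC := smooth_lie_bracket LC sB sC.
  have := curvature_opE sA sBC sZ UP.
  rewrite normal_bracket// Rop0_2// /curvature_op.
  rewrite (@nabla_zero_l (lie_bracket B C) (nabla A Z))//.
  - by rewrite nZ ?subr0//; exact: (smooth_lie_bracket LC).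
  - exact: sN.
  - exact: normal_bracket.
rewrite !nabla_Rfield// !third// !subr0.
rewrite (@nabla_comm_normal V X (nabla Y Z))//; [|exact: sN|exact: nZ].
rewrite (@nabla_comm_normal V Y (nabla X Z))//; [|exact: sN|exact: nZ].
rewrite (@nabla_comm_normal X Y (nabla V Z))//; [|exact: sN|exact: nZ].
rewrite [_ - _ + (_ - _)]addrC.
by rewrite !addrA !subrK subrr.
Qed.

Lemma cross_terms_cancel P (a1 a2 a3 b1 b2 b3 c1 c2 c3 p q r s t m : tangent P) :
  a1 + p + q + (r + a2 + s) + (t + m + a3)
  - (b1 + r + t + (p + b2 + m) + (q + s + b3)) - (c1 + c2 + c3) =
  a1 - b1 - c1 + (a2 - b2 - c2) + (a3 - b3 - c3).
Proof.
apply: metric_nondeg => w.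
apply: (cross_terms_additive (f := fun a => metric a w)) => [a b|a].
  exact: metricDl.
by rewrite -scaleN1r metricZl mulN1r.
Qed.

(** The Ricci identity for the curvature tensor itself: if [nablaR] vanishes, two successive
    derivatives of [Rfield] follow the product rule, and in their commutator only the curvature
    acting on each argument remains. *)
Lemma parallel_curvature_commutator :
  (forall V X Y Z P, sf V -> sf X -> sf Y -> sf Z -> U P -> nablaR V X Y Z P = 0) ->
  forall P (u v x y z : tangent P), U P ->
  Rop u v (Rop x y z) =
  Rop (Rop u v x) y z + Rop x (Rop u v y) z + Rop x y (Rop u v z).
Proof.
move=> hS P u v x y z UP.
have sN A B : sf A -> sf B -> sf (nabla A B) by apply: smooth_nabla.
have D V X Y Z Q : sf V -> sf X -> sf Y -> sf Z -> U Q ->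
    nabla V (Rfield X Y Z) Q = Rfield (nabla V X) Y Z Q +
      Rfield X (nabla V Y) Z Q + Rfield X Y (nabla V Z) Q.
  move=> sV sX sY sZ UQ; have /eqP := hS _ _ _ _ _ sV sX sY sZ UQ.
  rewrite /nablaR !subr_eq add0r => /eqP ->.
  have E (a b d : tangent Q) : a + b + d = d + b + a by rewrite addrC (addrC a) addrA.
  exact: E.
pose A := extend u; pose B := extend v.
pose X := extend x; pose Y := extend y; pose Z := extend z.
have sA : sf A := smooth_extend u. have sB : sf B := smooth_extend v.
have sX : sf X := smooth_extend x. have sY : sf Y := smooth_extend y.
have sZ : sf Z := smooth_extend z.
have sR X1 Y1 Z1 := @smooth_Rfield X1 Y1 Z1.
have D2 V W : sf V -> sf W -> nabla V (nabla W (Rfield X Y Z)) P =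
    nabla V (Rfield (nabla W X) Y Z) P + nabla V (Rfield X (nabla W Y) Z) P
    + nabla V (Rfield X Y (nabla W Z)) P.
  move=> sV sW.
  have s1 : sf (Rfield (nabla W X) Y Z) by apply: sR => //; exact: sN.
  have s2 : sf (Rfield X (nabla W Y) Z) by apply: sR => //; exact: sN.
  have s3 : sf (Rfield X Y (nabla W Z)) by apply: sR => //; exact: sN.
  (* The product rule [D] holds on all of [U], not only at [P], and can therefore be differentiated
     once more. *)
  rewrite (@nabla_local _ _ _ _ LC c V V (nabla W (Rfield X Y Z))
    (fun Q => Rfield (nabla W X) Y Z Q + Rfield X (nabla W Y) Z Q
       + Rfield X Y (nabla W Z) Q))//.
  - rewrite (@nablaDr _ _ _ _ LC c)//; last exact: smooth_fieldD.
    by rewrite (@nablaDr _ _ _ _ LC c).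
  - exact: (sN _ _ sW (sR _ _ _ sX sY sZ)).
  - by move=> Q UQ; exact: D.
have sAB := smooth_lie_bracket LC sA sB.
have EA : A P = u by exact: extendE. have EB : B P = v by exact: extendE.
have EX : X P = x by exact: extendE. have EY : Y P = y by exact: extendE.
have EZ : Z P = z by exact: extendE.
have C W : sf W -> Rop u v (W P) = nabla A (nabla B W) P - nabla B (nabla A W) P
    - nabla (lie_bracket A B) W P.
  by move=> sW; rewrite -EA -EB -curvature_opE.
have Cx := C _ sX; have Cy := C _ sY; have Cz := C _ sZ.
have CR := C _ (sR _ _ _ sX sY sZ).
rewrite EX in Cx; rewrite EY in Cy; rewrite EZ in Cz.
rewrite {1}/Rfield EX EY EZ in CR.
rewrite CR Cx Cy Cz !D2// !D//; try exact: sN.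
rewrite /Rfield EX EY EZ.
have L1 y' z' : forall a x' x'', Rop (a *: x' + x'') y' z' = _ :=
  fun a x' x'' => @Rop_lin1 P a x' x'' y' z' UP.
have L2 y' z' : forall a x' x'', Rop y' (a *: x' + x'') z' = _ :=
  fun a x' x'' => @Rop_lin2 P a x' x'' y' z' UP.
have L3 y' z' : forall a x' x'', Rop y' z' (a *: x' + x'') = _ :=
  fun a x' x'' => @Rop_lin3 P a x' x'' y' z' UP.
have B1 (x' x'' y' z' : tangent P) : Rop (x' - x'') y' z' = Rop x' y' z' - Rop x'' y' z'.
  exact: (@linear_opB P (fun x => Rop x _ _) _ _ (L1 _ _)).
have B2 (x' x'' y' z' : tangent P) : Rop y' (x' - x'') z' = Rop y' x' z' - Rop y' x'' z'.
  exact: (@linear_opB P (fun x => Rop _ x _) _ _ (L2 _ _)).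
have B3 (x' x'' y' z' : tangent P) : Rop y' z' (x' - x'') = Rop y' z' x' - Rop y' z' x''.
  exact: (@linear_opB P (fun x => Rop _ _ x) _ _ (L3 _ _)).
rewrite !(B1, B2, B3).
exact: cross_terms_cancel.
Qed.

End curvature.

(** * The curvature operator of the model *)

(** Pairs are flattened as in the Kronecker product, so that a change of frame [B] acts on 2-tensors
    as [B *t B]. *)
Definition ix (a b : 'I_4) : 'I_(4 * 4) := mxtens_index (a, b).

Lemma sum_ix (V : nmodType) (F : 'I_(4 * 4) -> V) :
  \sum_k F k = \sum_a \sum_b F (ix a b).
Proof.
rewrite pair_big /= (reindex (@mxtens_index 4 4)) /=; last first.
  by apply: onW_bij; exists (@mxtens_unindex 4 4);
    [exact: mxtens_indexK|exact: mxtens_unindexK].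
by apply: eq_bigr => -[a b].
Qed.

Lemma ixP (k : 'I_(4 * 4)) : exists a b, k = ix a b.
Proof.
exists (mxtens_unindex k).1, (mxtens_unindex k).2.
by rewrite /ix -surjective_pairing mxtens_unindexK.
Qed.

Lemma ix_eq (a b c d : 'I_4) : (ix a b == ix c d) = (a == c) && (b == d).
Proof. by rewrite (inj_eq (can_inj (@mxtens_indexK 4 4))) xpair_eqE. Qed.

Definition pair_sign (a b : nat) : int * nat :=
  (match a, b with
   | 0, 1 => (1%Z, 0) | 0, 2 => (1%Z, 1) | 0, 3 => (1%Z, 2)
   | 1, 2 => (1%Z, 3) | 1, 3 => (1%Z, 4) | 2, 3 => (1%Z, 5)
   | 1, 0 => ((-1)%Z, 0) | 2, 0 => ((-1)%Z, 1) | 3, 0 => ((-1)%Z, 2)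
   | 2, 1 => ((-1)%Z, 3) | 3, 1 => ((-1)%Z, 4) | 3, 2 => ((-1)%Z, 5)
   | _, _ => (0%Z, 0)
   end)%N.

Definition pair_curv (i j : nat) : int :=
  (match i, j with
   | 0, 0 | 5, 5 => (-2)%Z
   | 1, 1 | 4, 4 | 1, 4 | 4, 1 | 2, 3 | 3, 2 => 1%Z
   | 2, 2 | 3, 3 => (-1)%Z
   | _, _ => 0%Z
   end)%N.

(* The components of the model in units of mu / 2; the pairs 01, 02, 03, 12, 13,
   23 are numbered from 0 to 5. *)
Definition curv_int (a b c d : nat) : int :=
  (pair_sign a b).1 * (pair_sign c d).1 *
  pair_curv (pair_sign a b).2 (pair_sign c d).2.

(** An executable form of the sum, in which the cubic identity becomes a finite computation. *)
Definition sumz (m : nat) (F : nat -> int) : int :=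
  foldr (fun k z => F k + z) 0 (iota 0 m).

Definition curv_int2 (i j : nat) : int :=
  curv_int (i %/ 4) (i %% 4) (j %/ 4) (j %% 4).

(** In units of [mu / 2] the nonzero eigenvalues on 2-tensors are 4 and -4, whence the factor 16. *)
Lemma curv_int_cubic : all (fun i => all (fun j =>
  sumz 16 (fun k => sumz 16 (fun l => curv_int2 i l * curv_int2 l k) * curv_int2 k j)
    == 16 * curv_int2 i j) (iota 0 16)) (iota 0 16).
Proof. by vm_compute. Qed.

Lemma sumzE m F : sumz m F = \sum_(k < m) F k.
Proof. by rewrite -(big_mkord xpredT) unlock /index_iota subn0. Qed.

Definition o0 : 'I_4 := @Ordinal 4 0 isT.
Definition o1 : 'I_4 := @Ordinal 4 1 isT.
Definition o2 : 'I_4 := @Ordinal 4 2 isT.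
Definition o3 : 'I_4 := @Ordinal 4 3 isT.

Section model.
Variables (R : realType) (mu : R).

Lemma C4_compE (a b c d : 'I_4) :
  C4_comp mu a b c d = mu / 2 * (curv_int a b c d)%:~R.
Proof.
case: a => -[|[|[|[|//]]]] ?; case: b => -[|[|[|[|//]]]] ?;
case: c => -[|[|[|[|//]]]] ?; case: d => -[|[|[|[|//]]]] ?;
rewrite /C4_comp /curv_int /=; lra.
Qed.

Definition Cmx : 'M[R]_(4 * 4) := \matrix_(i, j) (mu / 2 * (curv_int2 i j)%:~R).

Lemma Cmx_ix (a b c d : 'I_4) : Cmx (ix a b) (ix c d) = C4_comp mu a b c d.
Proof.
have E1 (x y : 'I_4) : (ix x y %/ 4 = x)%N.
  by rewrite /ix /mxtens_index /= divnMDl// divn_small// addn0.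
have E2 (x y : 'I_4) : (ix x y %% 4 = y)%N.
  by rewrite /ix /mxtens_index /= modnMDl modn_small.
by rewrite mxE C4_compE /curv_int2 !E1 !E2.
Qed.

Lemma Cmx_cubic : Cmx *m Cmx *m Cmx = (4 * mu ^+ 2) *: Cmx.
Proof.
apply/matrixP => i j; rewrite !mxE.
under eq_bigr => k _.
  rewrite !mxE.
  under eq_bigr => l _ do rewrite !mxE mulrACA -intrM.
  rewrite -mulr_sumr -rmorph_sum mulrACA /= -intrM.
  over.
rewrite -mulr_sumr -rmorph_sum /=.
have -> : \sum_(k < 4 * 4) (\sum_(l < 4 * 4) curv_int2 i l * curv_int2 l k) *
    curv_int2 k j = 16 * curv_int2 i j.
  have /allP/(_ i) := curv_int_cubic; rewrite mem_iota ltn_ord => /(_ isT).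
  move=> /allP/(_ j); rewrite mem_iota ltn_ord => /(_ isT)/eqP <-.
  by rewrite sumzE; apply: eq_bigr => k _; rewrite sumzE.
by rewrite intrM; field.
Qed.

Definition ricci_mx (N : 'M[R]_(4 * 4)) : 'M[R]_4 :=
  \matrix_(a, d) \sum_b N (ix a b) (ix b d).

(** [ricci_mx] contracts a lower index with an upper one: summing [B' k b * B b j] over [b] gives a
    Kronecker delta, so the contraction is equivariant under every change of frame. *)
Lemma ricci_mx_conj (X : 'M[R]_(4 * 4)) (B B' : 'M[R]_4) : B' *m B = 1%:M ->
  ricci_mx ((B *t B) *m X *m (B' *t B')) = B *m ricci_mx X *m B'.
Proof.
move=> BB; apply/matrixP => a d; rewrite mxE.
have E b : ((B *t B) *m X *m (B' *t B')) (ix a b) (ix b d) =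
    \sum_k \sum_l \sum_i \sum_j
      B a i * X (ix i j) (ix k l) * B' l d * (B' k b * B b j).
  rewrite mxE sum_ix; apply: eq_bigr => k _; apply: eq_bigr => l _.
  rewrite tensmxE mxE sum_ix mulr_suml; apply: eq_bigr => i _.
  by rewrite mulr_suml; apply: eq_bigr => j _; rewrite tensmxE; ring.
under eq_bigr => b _ do rewrite E.
rewrite mxE exchange_big /=.
under eq_bigr => k _ do rewrite exchange_big /=.
rewrite exchange_big /=; apply: eq_bigr => l _.
rewrite mxE mulr_suml.
under eq_bigr => k _ do (rewrite exchange_big /=; under eq_bigr => i _ do rewrite exchange_big /=).
rewrite exchange_big /=; apply: eq_bigr => i _.
rewrite mxE mulr_sumr mulr_suml; apply: eq_bigr => k _.
transitivity (\sum_j B a i * X (ix i j) (ix k l) * B' l d * (k == j)%:R).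
  apply: eq_bigr => j _; rewrite -mulr_sumr; congr (_ * _).
  by have := congr1 (fun M : 'M[R]_4 => M k j) BB; rewrite !mxE.
rewrite (bigD1 k) //= eqxx mulr1 big1 ?addr0 ?mulrA// => j jk.
by rewrite eq_sym (negbTE jk) mulr0.
Qed.

Lemma ord4P (a : 'I_4) : [\/ a = o0, a = o1, a = o2 | a = o3].
Proof.
case: a => -[|[|[|[|//]]]] i; [apply: Or41|apply: Or42|apply: Or43|apply: Or44];
  exact: val_inj.
Qed.

Lemma sum4 (V : nmodType) (F : 'I_4 -> V) :
  \sum_a F a = F o0 + F o1 + F o2 + F o3.
Proof.
rewrite !big_ord_recl big_ord0 addr0 !addrA.
by congr (F _ + F _ + F _ + F _); exact: val_inj.
Qed.

Lemma ricci_mx_Cmx : ricci_mx Cmx = mu%:M.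
Proof.
apply/matrixP => a d; rewrite !mxE sum4 !Cmx_ix !C4_compE.
by case: (ord4P a) => ->; case: (ord4P d) => ->; rewrite /curv_int /=; lra.
Qed.

Lemma Cmx_sym : Cmx^T = Cmx.
Proof.
apply/matrixP => i j; have [a [b ->]] := ixP i; have [c [d ->]] := ixP j.
by rewrite mxE !Cmx_ix; have [_ ->] := C4_comp_sym mu a b c d.
Qed.

End model.

(** Between two eigenvectors for [l], each of the three terms on the left multiplies the pairing by
    [l ^+ 2], and the right-hand side multiplies it by [k]. The last hypothesis says that [l] is not
    a critical point of X^3 - k X. *)
Lemma tangent_eigen (F : fieldType) m (T N : 'M[F]_m) k l (v : 'rV[F]_m) (u : 'cV[F]_m) :
  T *m N *m N + N *m T *m N + N *m N *m T = k *: T ->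
  v *m N = l *: v -> N *m u = l *: u -> 3 * l ^+ 2 - k != 0 ->
  v *m T *m u = 0.
Proof.
move=> E Ev Eu nz.
have := congr1 (fun X => v *m X *m u) E.
rewrite !mulmxDr !mulmxDl !mulmxA Ev -!scalemxAl Ev -!scalemxAl.
rewrite -!(mulmxA _ N u) Eu -!scalemxAr -!(mulmxA _ N u) Eu -!scalemxAr.
rewrite -!scalemxAl !scalerA -!scalerDl => /eqP.
rewrite -subr_eq0 -scalerBl scaler_eq0 => /orP[|/eqP //].
by rewrite (_ : _ - _ = 3 * l ^+ 2 - k) ?(negbTE nz)//; ring.
Qed.

(** * Linear algebra of the derivative of the curvature *)

Section tensor_linear_algebra.
Variables (R : realType) (I : Type) (o0 o1 o2 o3 : I).
Variable t : I -> I -> I -> I -> I -> R.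
Hypothesis cases : forall a, [\/ a = o0, a = o1, a = o2 | a = o3].
Hypothesis y : forall m a b c d, t m c d a b = t m a b c d.
Hypothesis z1 : forall m a b c d, t m b a c d = - t m a b c d.
Hypothesis B4 : forall m a b c d, t m a b c d + t a b m c d + t b m a c d = 0.
Hypothesis R4 : forall m a d,
  t m a o0 o0 d + t m a o1 o1 d + t m a o2 o2 d + t m a o3 o3 d = 0.
(* Tangency to the orbit of the model: the derivative of the curvature operator
   pairs to zero any two eigenforms of equal eigenvalue. The two-forms involved
   are 01 +- 23, 03 +- 12 and 02 +- 13. *)
Let eig m a b c d s a' b' c' d' s' :=
  t m a b a' b' + s' * t m a b c' d' + s * t m c d a' b' + s * s' * t m c d c' d' = 0.
Hypothesis e11 : forall m, eig m o0 o1 o2 o3 (1) o0 o1 o2 o3 (1).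
Hypothesis e12 : forall m, eig m o0 o1 o2 o3 (1) o0 o1 o2 o3 (-1).
Hypothesis e13 : forall m, eig m o0 o1 o2 o3 (1) o0 o3 o1 o2 (-1).
Hypothesis e22 : forall m, eig m o0 o1 o2 o3 (-1) o0 o1 o2 o3 (-1).
Hypothesis e23 : forall m, eig m o0 o1 o2 o3 (-1) o0 o3 o1 o2 (-1).
Hypothesis e33 : forall m, eig m o0 o3 o1 o2 (-1) o0 o3 o1 o2 (-1).
Hypothesis f11 : forall m, eig m o0 o3 o1 o2 (1) o0 o3 o1 o2 (1).
Hypothesis f12 : forall m, eig m o0 o3 o1 o2 (1) o0 o2 o1 o3 (-1).
Hypothesis f22 : forall m, eig m o0 o2 o1 o3 (-1) o0 o2 o1 o3 (-1).
Hypothesis g11 : forall m, eig m o0 o2 o1 o3 (1) o0 o2 o1 o3 (1).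

Let z2 m a b c d : t m a b d c = - t m a b c d.
Proof. by rewrite y z1 y. Qed.

Let z0 m a c d : t m a a c d = 0.
Proof. by have := z1 m a a c d; lra. Qed.

Let z0' m a c d : t m c d a a = 0.
Proof. by rewrite y z0. Qed.

(** A symmetric form on the six-dimensional space of two-forms has 21 components. The ten eigenform
    equations and the ten Ricci equations together have rank 17, and the four remaining components
    parametrise the solutions. *)
Let reduction m : t m o0 o1 o0 o1 = 0 /\
     t m o0 o1 o2 o3 = 0 /\
     t m o2 o3 o2 o3 = 0 /\
     t m o0 o2 o0 o2 = 0 /\
     t m o0 o2 o1 o3 = 0 /\
     t m o1 o3 o1 o3 = 0 /\
     t m o0 o3 o0 o3 = 0 /\
     t m o0 o3 o1 o2 = 0 /\
     t m o1 o2 o1 o2 = 0 /\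
     t m o0 o1 o0 o2 = - t m o1 o3 o2 o3 /\
     t m o0 o1 o0 o3 = t m o1 o2 o2 o3 /\
     t m o0 o1 o1 o2 = t m o1 o2 o2 o3 /\
     t m o0 o1 o1 o3 = - t m o0 o2 o2 o3 /\
     t m o0 o2 o0 o3 = - t m o1 o2 o1 o3 /\
     t m o0 o2 o1 o2 = t m o1 o2 o1 o3 /\
     t m o0 o3 o1 o3 = - t m o1 o2 o1 o3 /\
     t m o0 o3 o2 o3 = t m o1 o2 o2 o3.
Proof.
have := e11 m; rewrite /eig => he11.
have := e12 m; rewrite /eig => he12.
have := e13 m; rewrite /eig => he13.
have := e22 m; rewrite /eig => he22.
have := e23 m; rewrite /eig => he23.
have := e33 m; rewrite /eig => he33.
have := f11 m; rewrite /eig => hf11.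
have := f12 m; rewrite /eig => hf12.
have := f22 m; rewrite /eig => hf22.
have := g11 m; rewrite /eig => hg11.
have r00 := R4 m o0 o0.
have r01 := R4 m o0 o1.
have r02 := R4 m o0 o2.
have r03 := R4 m o0 o3.
have r11 := R4 m o1 o1.
have r12 := R4 m o1 o2.
have r13 := R4 m o1 o3.
have r22 := R4 m o2 o2.
have r23 := R4 m o2 o3.
have r33 := R4 m o3 o3.
(* These instances of the symmetries sort the indices, so that every component has a single name and
   the system becomes linear in 21 unknowns. *)
rewrite !(z0, z0', z1 _ o0 o1, z1 _ o0 o2, z1 _ o0 o3, z1 _ o1 o2, z1 _ o1 o3, z1 _ o2 o3,
    z2 _ _ _ o0 o1, z2 _ _ _ o0 o2, z2 _ _ _ o0 o3, z2 _ _ _ o1 o2, z2 _ _ _ o1 o3, z2 _ _ _ o2 o3) in r00 r01 r02 r03 r11 r12 r13 r22 r23 r33.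
rewrite ?(y _ o0 o1 o0 o2, y _ o0 o1 o0 o3, y _ o0 o1 o1 o2, y _ o0 o1 o1 o3, y _ o0 o1 o2 o3,
    y _ o0 o2 o0 o3, y _ o0 o2 o1 o2, y _ o0 o2 o1 o3, y _ o0 o2 o2 o3,
    y _ o0 o3 o1 o2, y _ o0 o3 o1 o3, y _ o0 o3 o2 o3,
    y _ o1 o2 o1 o3, y _ o1 o2 o2 o3,
    y _ o1 o3 o2 o3) in he11 he12 he13 he22 he23 he33 hf11 hf12 hf22 hg11 r00 r01 r02 r03 r11 r12 r13 r22 r23 r33.
by repeat split; lra.
Qed.

(** Each of the four directions contributes four unknowns; the sixteen Bianchi equations selected in
    the proof form a square nonsingular system for them. *)
Let free_zero :
     t o0 o1 o2 o1 o3 = 0 /\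
     t o0 o1 o2 o2 o3 = 0 /\
     t o0 o0 o2 o2 o3 = 0 /\
     t o0 o1 o3 o2 o3 = 0 /\
     t o1 o1 o2 o1 o3 = 0 /\
     t o1 o1 o2 o2 o3 = 0 /\
     t o1 o0 o2 o2 o3 = 0 /\
     t o1 o1 o3 o2 o3 = 0 /\
     t o2 o1 o2 o1 o3 = 0 /\
     t o2 o1 o2 o2 o3 = 0 /\
     t o2 o0 o2 o2 o3 = 0 /\
     t o2 o1 o3 o2 o3 = 0 /\
     t o3 o1 o2 o1 o3 = 0 /\
     t o3 o1 o2 o2 o3 = 0 /\
     t o3 o0 o2 o2 o3 = 0 /\
     t o3 o1 o3 o2 o3 = 0.
Proof.
have [k0_0 [k0_1 [k0_2 [k0_3 [k0_4 [k0_5 [k0_6 [k0_7 [k0_8 [k0_9 [k0_10 [k0_11 [k0_12 [k0_13 [k0_14 [k0_15 k0_16]]]]]]]]]]]]]]]] := reduction o0.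
have [k1_0 [k1_1 [k1_2 [k1_3 [k1_4 [k1_5 [k1_6 [k1_7 [k1_8 [k1_9 [k1_10 [k1_11 [k1_12 [k1_13 [k1_14 [k1_15 k1_16]]]]]]]]]]]]]]]] := reduction o1.
have [k2_0 [k2_1 [k2_2 [k2_3 [k2_4 [k2_5 [k2_6 [k2_7 [k2_8 [k2_9 [k2_10 [k2_11 [k2_12 [k2_13 [k2_14 [k2_15 k2_16]]]]]]]]]]]]]]]] := reduction o2.
have [k3_0 [k3_1 [k3_2 [k3_3 [k3_4 [k3_5 [k3_6 [k3_7 [k3_8 [k3_9 [k3_10 [k3_11 [k3_12 [k3_13 [k3_14 [k3_15 k3_16]]]]]]]]]]]]]]]] := reduction o3.
have b012_01 := B4 o0 o1 o2 o0 o1.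
have b012_02 := B4 o0 o1 o2 o0 o2.
have b012_03 := B4 o0 o1 o2 o0 o3.
have b012_12 := B4 o0 o1 o2 o1 o2.
have b012_13 := B4 o0 o1 o2 o1 o3.
have b012_23 := B4 o0 o1 o2 o2 o3.
have b013_01 := B4 o0 o1 o3 o0 o1.
have b013_02 := B4 o0 o1 o3 o0 o2.
have b013_03 := B4 o0 o1 o3 o0 o3.
have b013_12 := B4 o0 o1 o3 o1 o2.
have b013_13 := B4 o0 o1 o3 o1 o3.
have b013_23 := B4 o0 o1 o3 o2 o3.
have b023_03 := B4 o0 o2 o3 o0 o3.
have b023_12 := B4 o0 o2 o3 o1 o2.
have b123_03 := B4 o1 o2 o3 o0 o3.
have b123_12 := B4 o1 o2 o3 o1 o2.
rewrite ?(z1 _ o0 o1, z1 _ o0 o2, z1 _ o0 o3, z1 _ o1 o2, z1 _ o1 o3, z1 _ o2 o3) in b012_01 b012_02 b012_03 b012_12 b012_13 b012_23 b013_01 b013_02 b013_03 b013_12 b013_13 b013_23 b023_03 b023_12 b123_03 b123_12.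
rewrite ?(y _ o0 o1 o0 o2, y _ o0 o1 o0 o3, y _ o0 o1 o1 o2, y _ o0 o1 o1 o3, y _ o0 o1 o2 o3,
    y _ o0 o2 o0 o3, y _ o0 o2 o1 o2, y _ o0 o2 o1 o3, y _ o0 o2 o2 o3,
    y _ o0 o3 o1 o2, y _ o0 o3 o1 o3, y _ o0 o3 o2 o3,
    y _ o1 o2 o1 o3, y _ o1 o2 o2 o3,
    y _ o1 o3 o2 o3) in b012_01 b012_02 b012_03 b012_12 b012_13 b012_23 b013_01 b013_02 b013_03 b013_12 b013_13 b013_23 b023_03 b023_12 b123_03 b123_12.
rewrite ?(k0_0, k0_1, k0_2, k0_3, k0_4, k0_5, k0_6, k0_7, k0_8, k0_9, k0_10, k0_11, k0_12, k0_13, k0_14, k0_15, k0_16,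
    k1_0, k1_1, k1_2, k1_3, k1_4, k1_5, k1_6, k1_7, k1_8, k1_9, k1_10, k1_11, k1_12, k1_13, k1_14, k1_15, k1_16,
    k2_0, k2_1, k2_2, k2_3, k2_4, k2_5, k2_6, k2_7, k2_8, k2_9, k2_10, k2_11, k2_12, k2_13, k2_14, k2_15, k2_16,
    k3_0, k3_1, k3_2, k3_3, k3_4, k3_5, k3_6, k3_7, k3_8, k3_9, k3_10, k3_11, k3_12, k3_13, k3_14, k3_15, k3_16)
  in b012_01 b012_02 b012_03 b012_12 b012_13 b012_23 b013_01 b013_02 b013_03 b013_12 b013_13 b013_23 b023_03 b023_12 b123_03 b123_12.
clear k0_0 k0_1 k0_2 k0_3 k0_4 k0_5 k0_6 k0_7 k0_8 k0_9 k0_10 k0_11 k0_12 k0_13 k0_14 k0_15 k0_16 k1_0 k1_1 k1_2 k1_3 k1_4 k1_5 k1_6 k1_7 k1_8 k1_9 k1_10 k1_11 k1_12 k1_13 k1_14 k1_15 k1_16 k2_0 k2_1 k2_2 k2_3 k2_4 k2_5 k2_6 k2_7 k2_8 k2_9 k2_10 k2_11 k2_12 k2_13 k2_14 k2_15 k2_16 k3_0 k3_1 k3_2 k3_3 k3_4 k3_5 k3_6 k3_7 k3_8 k3_9 k3_10 k3_11 k3_12 k3_13 k3_14 k3_15 k3_16.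
by repeat split; lra.
Qed.

Let skew_zero (f : I -> I -> R) : (forall a b, f b a = - f a b) ->
  f o0 o1 = 0 -> f o0 o2 = 0 -> f o0 o3 = 0 -> f o1 o2 = 0 -> f o1 o3 = 0 ->
  f o2 o3 = 0 -> forall a b, f a b = 0.
Proof.
move=> fN w01 w02 w03 w12 w13 w23 a b.
have f0 c : f c c = 0 by have := fN c c; lra.
have g10 : f o1 o0 = 0 by rewrite fN w01 oppr0.
have g20 : f o2 o0 = 0 by rewrite fN w02 oppr0.
have g30 : f o3 o0 = 0 by rewrite fN w03 oppr0.
have g21 : f o2 o1 = 0 by rewrite fN w12 oppr0.
have g31 : f o3 o1 = 0 by rewrite fN w13 oppr0.
have g32 : f o3 o2 = 0 by rewrite fN w23 oppr0.
by case: (cases a) => ->; case: (cases b) => ->.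
Qed.

Lemma tensor_zero m a b c d : t m a b c d = 0.
Proof.
have [k0 [k1 [k2 [k3 [k4 [k5 [k6 [k7 [k8 [k9 [k10 [k11 [k12 [k13 [k14 [k15 k16]]]]]]]]]]]]]]]] := reduction m.
have [u0 [u1 [u2 [u3 [u4 [u5 [u6 [u7 [u8 [u9 [u10 [u11 [u12 [u13 [u14 u15]]]]]]]]]]]]]]] := free_zero.
have x1 : t m o1 o2 o1 o3 = 0 by case: (cases m) => ->.
have x2 : t m o1 o2 o2 o3 = 0 by case: (cases m) => ->.
have x3 : t m o0 o2 o2 o3 = 0 by case: (cases m) => ->.
have x4 : t m o1 o3 o2 o3 = 0 by case: (cases m) => ->.
rewrite ?(x1, x2, x3, x4, oppr0) in k9 k10 k11 k12 k13 k14 k15 k16.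
apply: (skew_zero (f := t m a b)) => [x z||||||]; first exact: z2.
all: apply: (skew_zero (f := fun a b => t m a b _ _)) => [x z||||||]; first exact: z1.
all: by rewrite // y.
Qed.

End tensor_linear_algebra.

(** * Eigenforms of the model *)

Section model.
Variables (R : realType) (mu : R).

Definition bivector (a b : 'I_4) : 'rV[R]_(4 * 4) :=
  delta_mx 0 (ix a b) - delta_mx 0 (ix b a).

(** For complementary pairs [a], [b] and [c], [d] and [s] a sign, this is a self-dual or
    anti-self-dual two-form. *)
Definition dual_pair (a b c d : 'I_4) (s : R) : 'rV[R]_(4 * 4) :=
  bivector a b + s *: bivector c d.

Lemma eigen_dual_pair (a b c d : 'I_4) s l :
  (forall x y : 'I_4,
     C4_comp mu a b x y - C4_comp mu b a x y
       + s * (C4_comp mu c d x y - C4_comp mu d c x y) =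
     l * (((x == a) && (y == b))%:R - ((x == b) && (y == a))%:R
       + s * (((x == c) && (y == d))%:R - ((x == d) && (y == c))%:R))) ->
  dual_pair a b c d s *m Cmx mu = l *: dual_pair a b c d s.
Proof.
move=> E; apply/rowP => k; have [x [y ->]] := ixP k.
rewrite /dual_pair /bivector mulmxDl -scalemxAl !mulmxBl -!rowE.
have F (p q : 'I_4) : row (ix p q) (Cmx mu) 0 (ix x y) = C4_comp mu p q x y.
  by rewrite [LHS]mxE Cmx_ix.
have G (p q : 'I_4) : (delta_mx 0 (ix p q) : 'rV[R]_(4 * 4)) 0 (ix x y) =
    ((x == p) && (y == q))%:R.
  by rewrite mxE eqxx ix_eq.
do ![rewrite [(_ + _ : 'rV[R]_(4 * 4)) 0 _]mxE | rewrite [(- _ : 'rV[R]_(4 * 4)) 0 _]mxE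
   | rewrite [(_ *: _ : 'rV[R]_(4 * 4)) 0 _]mxE].
by rewrite !F !G E.
Qed.

Lemma bivector_mul (T : 'M[R]_(4 * 4)) (a b c d : 'I_4) :
  (forall a b k, T (ix b a) k = - T (ix a b) k) ->
  (forall a b k, T k (ix b a) = - T k (ix a b)) ->
  (bivector a b *m T *m (bivector c d)^T) 0 0 = 4 * T (ix a b) (ix c d).
Proof.
move=> s1 s2; rewrite /bivector mulmxBl -!rowE linearB /= !trmx_delta.
rewrite mulmxBr !mulmxBl -!colE.
have F (p q : 'I_(4 * 4)) : col q (row p T) 0 0 = T p q by rewrite !mxE.
do ![rewrite [(_ + _ : 'M[R]_(1, 1)) 0 _]mxE | rewrite [(- _ : 'M[R]_(1, 1)) 0 _]mxE].
by rewrite !F !(s2 c d) !(s1 a b); ring.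
Qed.

Lemma row_mul_expand m (T : 'M[R]_m) (A B C D : 'rV[R]_m) s t :
  ((A + s *: B) *m T *m (C + t *: D)^T) 0 0 =
  (A *m T *m C^T) 0 0 + t * (A *m T *m D^T) 0 0 + s * (B *m T *m C^T) 0 0
    + s * t * (B *m T *m D^T) 0 0.
Proof.
have -> : (C + t *: D)^T = C^T + t *: D^T by apply/matrixP => i j; rewrite !mxE.
rewrite mulmxDr -!scalemxAr !mulmxDl -!scalemxAl.
do ![rewrite [(_ + _ : 'M[R]_(1, 1)) 0 _]mxE | rewrite [(_ *: _ : 'M[R]_(1, 1)) 0 _]mxE].
by ring.
Qed.

Lemma dual_pair_mul (T : 'M[R]_(4 * 4)) (a b c d a' b' c' d' : 'I_4) s t :
  (forall a b k, T (ix b a) k = - T (ix a b) k) ->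
  (forall a b k, T k (ix b a) = - T k (ix a b)) ->
  (dual_pair a b c d s *m T *m (dual_pair a' b' c' d' t)^T) 0 0 =
  4 * (T (ix a b) (ix a' b') + t * T (ix a b) (ix c' d')
     + s * T (ix c d) (ix a' b') + s * t * T (ix c d) (ix c' d')).
Proof.
move=> s1 s2; rewrite [LHS]row_mul_expand (bivector_mul a b a' b' s1 s2).
rewrite (bivector_mul a b c' d' s1 s2) (bivector_mul c d a' b' s1 s2).
by rewrite (bivector_mul c d c' d' s1 s2); ring.
Qed.

Hypothesis mu0 : mu != 0.

(** The algebraic core of the argument: [T m] stands for the covariant derivative of the curvature
    operator along the [m]-th vector of an orthonormal frame, and the third hypothesis is the second
    Bianchi identity. *)
Lemma tangent_curvature_zero (T : 'I_4 -> 'M[R]_(4 * 4)) :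
  (forall m a b k, T m (ix b a) k = - T m (ix a b) k) ->
  (forall m, (T m)^T = T m) ->
  (forall m a b k, T m (ix a b) k + T a (ix b m) k + T b (ix m a) k = 0) ->
  (forall m, ricci_mx (T m) = 0) ->
  (forall m, T m *m Cmx mu *m Cmx mu + Cmx mu *m T m *m Cmx mu +
     Cmx mu *m Cmx mu *m T m = (4 * mu ^+ 2) *: T m) ->
  forall m, T m = 0.
Proof.
move=> s1 sT bia ric tan.
have sy m i j : T m j i = T m i j by rewrite -[in LHS](sT m) mxE.
have s2 m a b k : T m k (ix b a) = - T m k (ix a b) by rewrite sy s1 sy.
have mu2 : mu ^+ 2 != 0 by rewrite expf_neq0.
have eig a b c d s a' b' c' d' t l m :
    3 * l ^+ 2 - 4 * mu ^+ 2 != 0 ->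
    dual_pair a b c d s *m Cmx mu = l *: dual_pair a b c d s ->
    dual_pair a' b' c' d' t *m Cmx mu = l *: dual_pair a' b' c' d' t ->
    T m (ix a b) (ix a' b') + t * T m (ix a b) (ix c' d')
     + s * T m (ix c d) (ix a' b') + s * t * T m (ix c d) (ix c' d') = 0.
  move=> nz E1 E2.
  have E3 : Cmx mu *m (dual_pair a' b' c' d' t)^T = l *: (dual_pair a' b' c' d' t)^T.
    by rewrite -{1}(Cmx_sym mu) -trmx_mul E2; apply/matrixP => i j; rewrite !mxE.
  have := congr1 (fun X : 'M[R]_(1, 1) => X 0 0) (tangent_eigen (tan m) E1 E3 nz).
  rewrite dual_pair_mul// => /eqP; rewrite mxE mulf_eq0 pnatr_eq0 /= => /eqP.
  exact.
have comp := (C4_compE mu).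
have nz1 : 3 * (- (2 * mu)) ^+ 2 - 4 * mu ^+ 2 != 0.
  by rewrite (_ : _ - _ = 8 * mu ^+ 2) ?mulf_neq0 ?pnatr_eq0//; ring.
have nz2 : 3 * (2 * mu) ^+ 2 - 4 * mu ^+ 2 != 0.
  by rewrite (_ : _ - _ = 8 * mu ^+ 2) ?mulf_neq0 ?pnatr_eq0//; ring.
have nz0 : 3 * (0 : R) ^+ 2 - 4 * mu ^+ 2 != 0.
  by rewrite expr0n mulr0 sub0r oppr_eq0 mulf_neq0// pnatr_eq0.
(* The index sum meets every two-form in both orders, which doubles the eigenvalues, and the
   convention R(x, y, y, x) for sectional curvature makes mu appear here as [- (2 * mu)]. *)
have p1 : dual_pair o0 o1 o2 o3 1 *m Cmx mu = (- (2 * mu)) *: dual_pair o0 o1 o2 o3 1.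
  by apply: eigen_dual_pair => x y; rewrite !comp /curv_int;
    case: (ord4P x) => ->; case: (ord4P y) => -> /=; lra.
have n1 : dual_pair o0 o1 o2 o3 (-1) *m Cmx mu = (- (2 * mu)) *: dual_pair o0 o1 o2 o3 (-1).
  by apply: eigen_dual_pair => x y; rewrite !comp /curv_int;
    case: (ord4P x) => ->; case: (ord4P y) => -> /=; lra.
have n3 : dual_pair o0 o3 o1 o2 (-1) *m Cmx mu = (- (2 * mu)) *: dual_pair o0 o3 o1 o2 (-1).
  by apply: eigen_dual_pair => x y; rewrite !comp /curv_int;
    case: (ord4P x) => ->; case: (ord4P y) => -> /=; lra.
have p3 : dual_pair o0 o3 o1 o2 1 *m Cmx mu = 0 *: dual_pair o0 o3 o1 o2 1.
  by apply: eigen_dual_pair => x y; rewrite !comp /curv_int;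
    case: (ord4P x) => ->; case: (ord4P y) => -> /=; lra.
have p2 : dual_pair o0 o2 o1 o3 (-1) *m Cmx mu = 0 *: dual_pair o0 o2 o1 o3 (-1).
  by apply: eigen_dual_pair => x y; rewrite !comp /curv_int;
    case: (ord4P x) => ->; case: (ord4P y) => -> /=; lra.
have n2 : dual_pair o0 o2 o1 o3 1 *m Cmx mu = (2 * mu) *: dual_pair o0 o2 o1 o3 1.
  by apply: eigen_dual_pair => x y; rewrite !comp /curv_int;
    case: (ord4P x) => ->; case: (ord4P y) => -> /=; lra.
pose t m a b c d : R := T m (ix a b) (ix c d).
move=> m; apply/matrixP => i j; have [a [b ->]] := ixP i; have [c [d ->]] := ixP j.
rewrite [RHS]mxE -/(t m a b c d).
apply: (tensor_zero (o0 := o0) (o1 := o1) (o2 := o2) (o3 := o3)).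
- exact: ord4P.
- by move=> *; exact: sy.
- by move=> *; exact: s1.
- by move=> *; exact: bia.
- move=> q x z; have := congr1 (fun X : 'M[R]_4 => X x z) (ric q).
  by rewrite !mxE sum4; exact.
- by move=> q; exact: (eig _ _ _ _ _ _ _ _ _ _ _ q nz1 p1 p1).
- by move=> q; exact: (eig _ _ _ _ _ _ _ _ _ _ _ q nz1 p1 n1).
- by move=> q; exact: (eig _ _ _ _ _ _ _ _ _ _ _ q nz1 p1 n3).
- by move=> q; exact: (eig _ _ _ _ _ _ _ _ _ _ _ q nz1 n1 n1).
- by move=> q; exact: (eig _ _ _ _ _ _ _ _ _ _ _ q nz1 n1 n3).
- by move=> q; exact: (eig _ _ _ _ _ _ _ _ _ _ _ q nz1 n3 n3).
- by move=> q; exact: (eig _ _ _ _ _ _ _ _ _ _ _ q nz0 p3 p3).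
- by move=> q; exact: (eig _ _ _ _ _ _ _ _ _ _ _ q nz0 p3 p2).
- by move=> q; exact: (eig _ _ _ _ _ _ _ _ _ _ _ q nz0 p2 p2).
- by move=> q; exact: (eig _ _ _ _ _ _ _ _ _ _ _ q nz2 n2 n2).
Qed.

End model.

(** * Derivatives of matrix-valued functions *)

Section matrix_derivative.
Variables (R : realType) (n : nat) (M : manifold R n) (P : M).

Definition mtdiff p q (F : M -> 'M[R]_(p, q)) :=
  forall i j, tdiff P (fun Q => F Q i j).

Definition mtder (v : tangent P) p q (F : M -> 'M[R]_(p, q)) : 'M[R]_(p, q) :=
  \matrix_(i, j) tder v (fun Q => F Q i j).

Lemma eq_tdiff (f g : M -> R) : (forall Q, f Q = g Q) -> tdiff P f -> tdiff P g.
Proof. by move=> /funext ->. Qed.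

Lemma eq_tder (v : tangent P) (f g : M -> R) : (forall Q, f Q = g Q) ->
  tder v f = tder v g.
Proof. by move=> /funext ->. Qed.

Lemma mtdiffM p q r (F : M -> 'M[R]_(p, q)) (G : M -> 'M[R]_(q, r)) :
  mtdiff F -> mtdiff G -> mtdiff (fun Q => F Q *m G Q).
Proof.
move=> dF dG i j; apply: (@eq_tdiff (fun Q => \sum_k F Q i k * G Q k j)).
  by move=> Q; rewrite mxE.
by apply: tdiff_sum => k; apply: tdiffM.
Qed.

Lemma mtderM v p q r (F : M -> 'M[R]_(p, q)) (G : M -> 'M[R]_(q, r)) :
  mtdiff F -> mtdiff G ->
  mtder v (fun Q => F Q *m G Q) = mtder v F *m G P + F P *m mtder v G.
Proof.
move=> dF dG; apply/matrixP => i j; rewrite !mxE -big_split /=.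
rewrite (@eq_tder _ _ (fun Q => \sum_k F Q i k * G Q k j)); last first.
  by move=> Q; rewrite mxE.
rewrite tder_sum; last by move=> k; apply: tdiffM.
by apply: eq_bigr => k _; rewrite tderM// !mxE addrC [G P k j * _]mulrC.
Qed.

Lemma mtder_near v p q (F G : M -> 'M[R]_(p, q)) : (\near P, F P = G P) ->
  mtdiff F -> mtder v G = mtder v F.
Proof.
move=> FG dF; apply/matrixP => i j; rewrite !mxE.
have FGij : \near P, F P i j = G P i j by apply: filterS FG => Q ->.
by have [_ ->] := tdiff_near v FGij (dF i j).
Qed.

Lemma mtder_cst v p q (A : 'M[R]_(p, q)) : mtder v (fun _ => A) = 0.
Proof. by apply/matrixP => i j; rewrite !mxE tder_cst. Qed.

Lemma mtdiff_cst p q (A : 'M[R]_(p, q)) : mtdiff (fun _ => A).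
Proof. by move=> i j; exact: tdiff_cst. Qed.

Lemma mtdiffZ p q a (F : M -> 'M[R]_(p, q)) : mtdiff F -> mtdiff (fun Q => a *: F Q).
Proof.
move=> dF i j; apply: (@eq_tdiff (fun Q => a * F Q i j)).
  by move=> Q; rewrite mxE.
by apply: tdiffM; [exact: tdiff_cst|exact: dF].
Qed.

Lemma mtderZ v p q a (F : M -> 'M[R]_(p, q)) : mtdiff F ->
  mtder v (fun Q => a *: F Q) = a *: mtder v F.
Proof.
move=> dF; apply/matrixP => i j; rewrite !mxE.
rewrite (@eq_tder _ _ (fun Q => a * F Q i j)); last by move=> Q; rewrite mxE.
by rewrite tderM ?tder_cst ?mulr0 ?addr0//; exact: tdiff_cst.
Qed.

Lemma tdiff_det p (F : M -> 'M[R]_p) : mtdiff F -> tdiff P (fun Q => \det (F Q)).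
Proof.
move=> dF; apply: tdiff_sum => s; apply: tdiffM; first exact: tdiff_cst.
by apply: tdiff_prod => i; exact: dF.
Qed.

Lemma mtdiff_adj p (F : M -> 'M[R]_p) : mtdiff F -> mtdiff (fun Q => \adj (F Q)).
Proof.
move=> dF i j.
apply: (@eq_tdiff (fun Q => (-1) ^+ (j + i) * \det (row' j (col' i (F Q))))).
  by move=> Q; rewrite mxE.
apply: tdiffM; first exact: tdiff_cst.
apply: tdiff_det => k l; apply: (@eq_tdiff (fun Q => F Q (lift j k) (lift i l))).
  by move=> Q; rewrite !mxE.
exact: dF.
Qed.

Lemma mtder_tens0 v p q (F : M -> 'M[R]_(p, q)) : mtdiff F -> mtder v F = 0 ->
  mtdiff (fun Q => F Q *t F Q) /\ mtder v (fun Q => F Q *t F Q) = 0.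
Proof.
move=> dF F0.
have F0' i j : tder v (fun Q => F Q i j) = 0.
  by have := congr1 (fun A : 'M[R]_(p, q) => A i j) F0; rewrite !mxE.
split=> [i j|].
  apply: (@eq_tdiff (fun Q => F Q (mxtens_unindex i).1 (mxtens_unindex j).1
       * F Q (mxtens_unindex i).2 (mxtens_unindex j).2)).
    by move=> Q; rewrite mxE.
  by apply: tdiffM; exact: dF.
apply/matrixP => i j; rewrite !mxE.
rewrite (@eq_tder _ _ (fun Q => F Q (mxtens_unindex i).1 (mxtens_unindex j).1
       * F Q (mxtens_unindex i).2 (mxtens_unindex j).2)).
  by rewrite tderM ?F0' ?mulr0 ?addr0.
by move=> Q; rewrite mxE.
Qed.

(** The adjugate formula makes the inverse differentiable; its derivative at [P] is then read off
    from [K Q *m G Q = 1%:M], which holds near [P], where the determinant is nonzero. *)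
Lemma mtder_inverse v p (G : M -> 'M[R]_p) : mtdiff G -> G P = 1%:M ->
  mtder v G = 0 ->
  exists K : M -> 'M[R]_p, [/\ mtdiff K, K P = 1%:M, mtder v K = 0 &
    \forall Q \near P, K Q *m G Q = 1%:M].
Proof.
move=> dG G1 G0; pose K Q := (\det (G Q))^-1 *: \adj (G Q).
have dd := tdiff_det dG.
have det1 : \det (G P) = 1 by rewrite G1 det1.
have dK : mtdiff K.
  move=> i j; apply: (@eq_tdiff (fun Q => (\det (G Q))^-1 * (\adj (G Q)) i j)).
    by move=> Q; rewrite [RHS]mxE.
  by apply: tdiffM; [apply: tdiffV => //; rewrite det1 oner_eq0|exact: mtdiff_adj].
have KG : \forall Q \near P, K Q *m G Q = 1%:M.
  have : \forall Q \near P, \det (G Q) != 0.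
    have := tdiff_continuous dd; rewrite det1 => /cvgr_neq0; apply.
    exact: oner_neq0.
  apply: filterS => Q nz.
  by rewrite -scalemxAl mul_adj_mx scale_scalar_mx mulVf.
have K1 : K P = 1%:M.
  by have := nbhs_singleton KG; rewrite G1 mulmx1.
exists K; split; [exact: dK|exact: K1| |exact: KG].
have : mtder v (fun Q => K Q *m G Q) = 0.
  rewrite (@mtder_near v _ _ (fun=> 1%:M)) ?mtder_cst//; last exact: mtdiff_cst.
  by apply: filterS KG => Q ->.
by rewrite (mtderM v dK dG) G1 G0 mulmx1 mulmx0 addr0.
Qed.

End matrix_derivative.

(** * The model curvature in an arbitrary frame *)

Section model_curvature.
Variables (R : realType) (mu : R).
Local Notation C := (C4_curv mu).

Lemma C4_curv_lin1 a x x' y z w : C (a *: x + x') y z w = a * C x y z w + C x' y z w.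
Proof.
rewrite /C4_curv mulr_sumr -big_split; apply: eq_bigr => i _ /=.
rewrite mulr_sumr -big_split; apply: eq_bigr => j _ /=.
rewrite mulr_sumr -big_split; apply: eq_bigr => k _ /=.
rewrite mulr_sumr -big_split; apply: eq_bigr => l _ /=.
by rewrite !mxE; ring.
Qed.

Lemma C4_curv_lin2 a x x' y z w : C y (a *: x + x') z w = a * C y x z w + C y x' z w.
Proof.
rewrite /C4_curv mulr_sumr -big_split; apply: eq_bigr => i _ /=.
rewrite mulr_sumr -big_split; apply: eq_bigr => j _ /=.
rewrite mulr_sumr -big_split; apply: eq_bigr => k _ /=.
rewrite mulr_sumr -big_split; apply: eq_bigr => l _ /=.
by rewrite !mxE; ring.
Qed.

Lemma C4_curv_lin3 a x x' y z w : C y z (a *: x + x') w = a * C y z x w + C y z x' w.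
Proof.
rewrite /C4_curv mulr_sumr -big_split; apply: eq_bigr => i _ /=.
rewrite mulr_sumr -big_split; apply: eq_bigr => j _ /=.
rewrite mulr_sumr -big_split; apply: eq_bigr => k _ /=.
rewrite mulr_sumr -big_split; apply: eq_bigr => l _ /=.
by rewrite !mxE; ring.
Qed.

Lemma C4_curv_skew x y z w : C y x z w = - C x y z w.
Proof.
rewrite /C4_curv exchange_big /= -sumrN; apply: eq_bigr => i _.
rewrite -sumrN; apply: eq_bigr => j _.
rewrite -sumrN; apply: eq_bigr => k _; rewrite -sumrN; apply: eq_bigr => l _.
by have [-> _] := C4_comp_sym mu i j k l; ring.
Qed.

Lemma C4_curv_pair x y z w : C z w x y = C x y z w.
Proof.
rewrite /C4_curv; under eq_bigr => i _ do rewrite exchange_big /=.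
rewrite exchange_big /=.
under eq_bigr => i _ do (under eq_bigr => j _ do rewrite exchange_big /=).
under eq_bigr => i _ do rewrite exchange_big /=.
apply: eq_bigr => i _; apply: eq_bigr => j _; apply: eq_bigr => k _; apply: eq_bigr => l _.
by have [_ ->] := C4_comp_sym mu i j k l; ring.
Qed.

Lemma tens1mx1 : (1%:M *t 1%:M : 'M[R]_(4 * 4)) = 1%:M.
Proof.
apply/matrixP => i j; have [a [b ->]] := ixP i; have [c [d ->]] := ixP j.
by rewrite tensmxE !mxE ix_eq -natrM mulnb.
Qed.

Lemma Cmx_frame (B : 'M[R]_4) (a b c d : 'I_4) :
  ((B *t B) *m Cmx mu *m (B *t B)^T) (ix a b) (ix c d) =
  C (row a B) (row b B) (row c B) (row d B).
Proof.
rewrite mxE sum_ix /C4_curv.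
transitivity (\sum_(k < 4) \sum_(l < 4) \sum_(i < 4) \sum_(j < 4)
   C4_comp mu i j k l * B a i * B b j * B c k * B d l).
  apply: eq_bigr => k _; apply: eq_bigr => l _.
  have -> : ((B *t B)^T) (ix k l) (ix c d) = B c k * B d l by rewrite mxE tensmxE.
  rewrite mxE sum_ix mulr_suml; apply: eq_bigr => i _.
  rewrite mulr_suml; apply: eq_bigr => j _.
  by rewrite Cmx_ix tensmxE; ring.
rewrite exchange_big /=; under eq_bigr => l _ do rewrite exchange_big /=.
rewrite exchange_big /=; apply: eq_bigr => i _.
under eq_bigr => l _ do rewrite exchange_big /=.
rewrite exchange_big /=; apply: eq_bigr => j _.
rewrite exchange_big /=; apply: eq_bigr => k _; apply: eq_bigr => l _.
by rewrite !mxE.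
Qed.

Lemma C4_curv_delta (a b c d : 'I_4) :
  C (delta_mx 0 a) (delta_mx 0 b) (delta_mx 0 c) (delta_mx 0 d) = C4_comp mu a b c d.
Proof.
have := Cmx_frame 1%:M a b c d.
by rewrite !row1 tens1mx1 trmx1 mul1mx mulmx1 Cmx_ix.
Qed.

Lemma C4_ip_delta (x : 'rV[R]_4) a : C4_ip x (delta_mx 0 a) = x 0 a.
Proof.
rewrite /C4_ip (bigD1 a)//= mxE !eqxx mulr1 big1 ?addr0// => b /negbTE ba.
by rewrite mxE ba andbF mulr0.
Qed.

End model_curvature.

(** * Curvature homogeneity forces parallel curvature *)

Section modelled.
Variables (R : realType) (mu : R).
Hypothesis mu0 : mu != 0.
Variable H : almost_hermitian R 4.
Variable nabla : vfield H -> vfield H -> vfield H.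
Hypothesis LC : levi_civita nabla.
Variable Rm : forall P : H, tangent P -> tangent P -> tangent P -> tangent P -> R.
Hypothesis CT : @curvature_tensor R 4 H nabla Rm.
Variable phi : forall P : H, {linear tangent P -> 'rV[R]_4}.
Variable psi : forall P : H, 'rV[R]_4 -> tangent P.
Hypothesis phiK : forall P, cancel (phi P) (psi P).
Hypothesis psiK : forall P, cancel (psi P) (phi P).
Hypothesis phi_ip : forall P x y, C4_ip (phi P x) (phi P y) = metric x y.
Hypothesis phi_curv : forall P x y z w,
  C4_curv mu (phi P x) (phi P y) (phi P z) (phi P w) = Rm x y z w.
Variable c : chart R 4 H.
Hypothesis Ac : atlas c.

Local Notation U := (cdom c).
Local Notation sf := (smooth_field (cdom c)).
Let oU : open U := @cdom_open _ _ _ c.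
Implicit Types (P Q : H) (X Y Z V W : vfield H).

Lemma Rm_lin1 P a x x' y z w :
  @Rm P (a *: x + x') y z w = a * Rm x y z w + Rm x' y z w.
Proof. by rewrite -!phi_curv linearP C4_curv_lin1. Qed.

Lemma Rm_lin2 P a x x' y z w :
  @Rm P y (a *: x + x') z w = a * Rm y x z w + Rm y x' z w.
Proof. by rewrite -!phi_curv linearP C4_curv_lin2. Qed.

Lemma Rm_lin3 P a x x' y z w :
  @Rm P y z (a *: x + x') w = a * Rm y z x w + Rm y z x' w.
Proof. by rewrite -!phi_curv linearP C4_curv_lin3. Qed.

Section at_point.
Variable P : H.
Hypothesis UP : U P.
Variable E : 'I_4 -> vfield H.
Hypothesis sE : forall a, sf (E a).
Hypothesis EP : forall a, E a P = psi P (delta_mx 0 a).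
Hypothesis nE : forall a, normal_at nabla c P (E a).

(** The frame in model coordinates. As [phi] is chosen pointwise, this matrix enters only through
    algebraic identities at each point; the matrices that get differentiated are [gram_mx] and
    [curv_mx]. *)
Definition frame_mx Q : 'M[R]_4 := \matrix_(a, i) (phi Q (E a Q)) 0 i.

Definition gram_mx Q : 'M[R]_4 := \matrix_(a, b) metric (E a Q) (E b Q).

Definition curv_mx Q : 'M[R]_(4 * 4) := \matrix_(i, j)
  Rm (E (mxtens_unindex i).1 Q) (E (mxtens_unindex i).2 Q)
     (E (mxtens_unindex j).1 Q) (E (mxtens_unindex j).2 Q).

Lemma curv_mx_ix Q a b k l :
  curv_mx Q (ix a b) (ix k l) = Rm (E a Q) (E b Q) (E k Q) (E l Q).
Proof. by rewrite mxE /ix !mxtens_indexK. Qed.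

Lemma gram_frame Q : gram_mx Q = frame_mx Q *m (frame_mx Q)^T.
Proof.
apply/matrixP => a b; rewrite !mxE -phi_ip; apply: eq_bigr => i _.
by rewrite !mxE.
Qed.

Lemma row_frame Q a : row a (frame_mx Q) = phi Q (E a Q).
Proof. by apply/rowP => i; rewrite !mxE. Qed.

Lemma curv_frame Q : curv_mx Q =
  (frame_mx Q *t frame_mx Q) *m Cmx mu *m (frame_mx Q *t frame_mx Q)^T.
Proof.
apply/matrixP => i j; have [a [b ->]] := ixP i; have [k [l ->]] := ixP j.
by rewrite curv_mx_ix Cmx_frame !row_frame phi_curv.
Qed.

Lemma frame_P : frame_mx P = 1%:M.
Proof.
by apply/row_matrixP => a; rewrite row_frame EP psiK row1.
Qed.

Lemma gram_P : gram_mx P = 1%:M.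
Proof. by rewrite gram_frame frame_P trmx1 mulmx1. Qed.

Lemma curv_P : curv_mx P = Cmx mu.
Proof. by rewrite curv_frame frame_P tens1mx1 trmx1 mulmx1 mul1mx. Qed.

Lemma gram_tdiff : mtdiff P gram_mx.
Proof.
move=> a b; apply: (@eq_tdiff _ _ _ _ (fun Q => metric (E a Q) (E b Q))).
  by move=> Q; rewrite mxE.
apply: smooth_fun_tdiff UP _; exact: metric_smooth.
Qed.

Lemma gram_tder m : mtder (E m P) gram_mx = 0.
Proof.
apply/matrixP => a b; rewrite !mxE.
rewrite (@eq_tder _ _ _ _ _ _ (fun Q => metric (E a Q) (E b Q))); last first.
  by move=> Q; rewrite mxE.
have := nabla_metric LC oU (sE m) (sE a) (sE b) UP; rewrite /fder => ->.
by rewrite !nE// metric0l metric0r addr0.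
Qed.

Lemma near_U : \forall Q \near P, U Q.
Proof. exact: open_nbhs_nbhs. Qed.

Lemma curv_near a b k l : \forall Q \near P,
  metric (Rfield nabla c (E a) (E b) (E k) Q) (E l Q) =
  curv_mx Q (ix a b) (ix k l).
Proof.
apply: filterS near_U => Q UQ.
by rewrite curv_mx_ix (metric_Rop CT Ac).
Qed.

Lemma smooth_curv a b k l :
  smooth_fun U (fun Q => metric (Rfield nabla c (E a) (E b) (E k) Q) (E l Q)).
Proof. by apply: metric_smooth => //; exact: (smooth_Rfield LC CT Ac). Qed.

Lemma curv_tdiff : mtdiff P curv_mx.
Proof.
move=> i j; have [a [b ->]] := ixP i; have [k [l ->]] := ixP j.
have d := smooth_fun_tdiff UP (smooth_curv a b k l).
by have [] := tdiff_near (E a P) (curv_near a b k l) d.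
Qed.

(** Of the two terms given by metric compatibility, the one containing the derivative of [E l]
    vanishes at [P]. Plain derivatives of the components are thus components of nabla R. *)
Lemma curv_tder m a b k l : mtder (E m P) curv_mx (ix a b) (ix k l) =
  metric (nabla (E m) (Rfield nabla c (E a) (E b) (E k)) P) (E l P).
Proof.
have d := smooth_fun_tdiff UP (smooth_curv a b k l).
have [_ E1] := tdiff_near (E m P) (curv_near a b k l) d.
rewrite mxE E1.
have sR := smooth_Rfield LC CT Ac (sE a) (sE b) (sE k).
have := nabla_metric LC oU (sE m) sR (sE l) UP; rewrite /fder => ->.
by rewrite nE// metric0r addr0.
Qed.

(* The curvature operator in the frame E, obtained by raising the last two
   indices with the inverse Gram matrix, is conjugate to that of the model. *)
Lemma curv_operator_conj Q K : K *m gram_mx Q = 1%:M ->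
  exists B B' : 'M[R]_4, B' *m B = 1%:M /\
    curv_mx Q *m (K *t K) = (B *t B) *m Cmx mu *m (B' *t B').
Proof.
move=> KG; exists (frame_mx Q), ((frame_mx Q)^T *m K); split.
  by rewrite -mulmxA; apply: mulmx1C; rewrite -mulmxA -gram_frame.
by rewrite curv_frame trmx_tens -!mulmxA tensmx_mul.
Qed.

Lemma curv_operator_cubic Q K : K *m gram_mx Q = 1%:M ->
  let N := curv_mx Q *m (K *t K) in
  N *m N *m N = (4 * mu ^+ 2) *: N.
Proof.
move=> /curv_operator_conj[B [B' [B'B ->]]] /=.
have S1 : (B' *t B') *m (B *t B) = 1%:M by rewrite tensmx_mul B'B tens1mx1.
have E1 (A D : 'M[R]_(4 * 4)) : (B *t B) *m A *m (B' *t B') *m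
    ((B *t B) *m D *m (B' *t B')) = (B *t B) *m (A *m D) *m (B' *t B').
  by rewrite -!mulmxA; congr (_ *m (_ *m _)); rewrite !mulmxA S1 mul1mx.
by rewrite !E1 Cmx_cubic -scalemxAr -scalemxAl.
Qed.

Lemma curv_operator_ricci Q K : K *m gram_mx Q = 1%:M ->
  ricci_mx (curv_mx Q *m (K *t K)) = mu%:M.
Proof.
move=> /curv_operator_conj[B [B' [B'B ->]]].
by rewrite ricci_mx_conj// ricci_mx_Cmx mul_mx_scalar -scalemxAl (mulmx1C B'B) scalemx1.
Qed.

(** The inverse Gram matrix has value 1 and derivative 0 at [P], so raising indices changes neither
    the value nor the derivative of [curv_mx] there, while the invariant identities hold for [N]
    near [P]. *)
Lemma curv_tder_equations m :
  let T := mtder (E m P) curv_mx in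
  T *m Cmx mu *m Cmx mu + Cmx mu *m T *m Cmx mu + Cmx mu *m Cmx mu *m T =
    (4 * mu ^+ 2) *: T /\ ricci_mx T = 0.
Proof.
have [K [dK K1 K0 KG]] := mtder_inverse gram_tdiff gram_P (gram_tder m).
have [dKK KK0] := mtder_tens0 dK K0.
pose N Q := curv_mx Q *m (K Q *t K Q).
have dN : mtdiff P N by apply: mtdiffM => //; exact: curv_tdiff.
have NP : N P = Cmx mu by rewrite /N K1 tens1mx1 mulmx1 curv_P.
have NT : mtder (E m P) N = mtder (E m P) curv_mx.
  rewrite mtderM//; last exact: curv_tdiff.
  by rewrite K1 tens1mx1 KK0 mulmx1 mulmx0 addr0.
move=> T; rewrite /T -NT; split.
  have dNN : mtdiff P (fun Q => N Q *m N Q) by exact: mtdiffM.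
  have D1 := mtderM (E m P) dNN dN.
  rewrite (mtderM (E m P) dN dN) NP mulmxDl in D1.
  have D2 : mtder (E m P) (fun Q => N Q *m N Q *m N Q) =
      mtder (E m P) (fun Q => (4 * mu ^+ 2) *: N Q).
    apply: mtder_near; last exact: mtdiffZ.
    by apply: filterS KG => Q KQ; exact: esym (curv_operator_cubic KQ).
  etransitivity; first exact: (esym D1).
  by rewrite D2; exact: mtderZ.
apply/matrixP => a d; rewrite !mxE.
have near_ric : \forall Q \near P, (\sum_b N Q (ix a b) (ix b d)) = (mu%:M : 'M[R]_4) a d.
  apply: filterS KG => Q /curv_operator_ricci E1.
  by rewrite -E1 mxE.
have dS : tdiff P (fun Q => \sum_b N Q (ix a b) (ix b d)) by exact: tdiff_sum.
have [_ E2] := tdiff_near (E m P) near_ric dS.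
rewrite tder_cst in E2; rewrite [RHS]E2 tder_sum//.
by apply: eq_bigr => b _; rewrite mxE.
Qed.

Lemma curv_tder_zero m : mtder (E m P) curv_mx = 0.
Proof.
apply: (tangent_curvature_zero mu0 (T := fun m => mtder (E m P) curv_mx)) => {m}.
- move=> m a b k'; have [k [l ->]] := ixP k'.
  rewrite ![_ (ix _ _) (ix _ _)]mxE.
  rewrite (@eq_tder _ _ _ _ _ _ (fun Q => (-1) * curv_mx Q (ix a b) (ix k l))).
    rewrite tderM; [|exact: tdiff_cst|exact: curv_tdiff].
    by rewrite tder_cst mulr0 addr0 mulN1r.
  by move=> Q; rewrite !curv_mx_ix -!phi_curv C4_curv_skew mulN1r.
- move=> m; apply/matrixP => i j.
  have [a [b ->]] := ixP i; have [k [l ->]] := ixP j; rewrite !mxE.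
  by apply: eq_tder => Q; rewrite !curv_mx_ix -!phi_curv C4_curv_pair.
- move=> m a b k'; have [k [l ->]] := ixP k'.
  rewrite !curv_tder -!metricDl.
  by rewrite (second_bianchi LC CT Rm_lin2 Rm_lin3 Ac)// metric0l.
- by move=> m; have [] := curv_tder_equations m.
- by move=> m; have [] := curv_tder_equations m.
Qed.

Lemma frame_span (x : tangent P) : exists xi : 'I_4 -> R, x = \sum_a xi a *: E a P.
Proof.
exists (phi P x 0); apply: (can_inj (@phiK P)).
rewrite linear_sum [LHS]row_sum_delta; apply: eq_bigr => a _.
by rewrite linearZ EP psiK.
Qed.

Lemma frame_metric_zero (x : tangent P) : (forall l, metric x (E l P) = 0) -> x = 0.
Proof.
move=> x0; apply: (can_inj (@phiK P)); apply/rowP => a.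
by rewrite linear0 mxE -(C4_ip_delta (phi P x)) -(psiK P (delta_mx 0 a)) phi_ip -EP.
Qed.

Lemma nablaR_zero_at V X Y Z : sf V -> sf X -> sf Y -> sf Z ->
  nablaR nabla c V X Y Z P = 0.
Proof.
apply: (nablaR_vanish LC CT Rm_lin1 Rm_lin2 Rm_lin3 Ac UP sE frame_span) => m a b k.
rewrite (nablaR_normal CT Rm_lin1 Rm_lin2 Rm_lin3 Ac)//.
by apply: frame_metric_zero => l; rewrite -curv_tder curv_tder_zero mxE.
Qed.

End at_point.

Lemma nablaR_zero V X Y Z P : sf V -> sf X -> sf Y -> sf Z -> U P ->
  nablaR nabla c V X Y Z P = 0.
Proof.
move=> sV sX sY sZ UP.
have ex a : exists Y, [/\ sf Y, Y P = psi P (delta_mx 0 a) & normal_at nabla c P Y].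
  have [F [sF FP nF]] := exists_normal_field LC Ac (smooth_extend Ac (psi P (delta_mx 0 a))) UP.
  by exists F; split=> //; rewrite FP extendE.
have /choice[E HE] := ex.
by apply: (@nablaR_zero_at P UP E) => // a; have [] := HE a.
Qed.

Local Notation e P a := (psi P (delta_mx 0 a)).

Lemma phi_Rop P (x y z a : 'I_4) : U P ->
  phi P (Rop nabla c (e P x) (e P y) (e P z)) 0 a = C4_comp mu x y z a.
Proof.
move=> UP; rewrite -C4_ip_delta -{1}(psiK P (delta_mx 0 a)) phi_ip.
by rewrite (metric_Rop CT Ac)// -phi_curv !psiK C4_curv_delta.
Qed.

Lemma not_modelled_at P : U P -> False.
Proof.
move=> UP.
have := parallel_curvature_commutator LC CT Rm_lin1 Rm_lin2 Rm_lin3 Ac nablaR_zero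
  (e P o0) (e P o1) (e P o0) (e P o2) (e P o0) UP.
have R1 : Rop nabla c (e P o0) (e P o2) (e P o0) = (mu / 2) *: e P o2.
  apply: (can_inj (@phiK P)); apply/rowP => a; rewrite phi_Rop// C4_compE linearZ psiK !mxE.
  by case: (ord4P a) => ->; rewrite /curv_int /=; lra.
have R2 : Rop nabla c (e P o0) (e P o1) (e P o0) = (- mu) *: e P o1.
  apply: (can_inj (@phiK P)); apply/rowP => a; rewrite phi_Rop// C4_compE linearZ psiK !mxE.
  by case: (ord4P a) => ->; rewrite /curv_int /=; lra.
have R3 : Rop nabla c (e P o0) (e P o1) (e P o2) = 0.
  apply: (can_inj (@phiK P)); apply/rowP => a; rewrite phi_Rop// C4_compE linear0 !mxE.
  by case: (ord4P a) => ->; rewrite /curv_int /=; lra.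
(* Along [e P o3] the left-hand side is [mu / 2] times a zero component of the model. On the right
   the middle term vanishes and each of the other two is [- mu] times [mu / 2], so the identity
   reads 0 = - mu^2. *)
rewrite R1 R2 R3 => /(congr1 (fun x => metric x (e P o3))).
rewrite [X in _ = X -> _]metricDl [X in _ = X + _ -> _]metricDl.
rewrite !(metric_Rop CT Ac _ _ _ _ UP).
rewrite -!phi_curv !linearZ linear0 /= !psiK.
have Z1 a x y z w : C4_curv mu (a *: x) y z w = a * C4_curv mu x y z w.
  have Z0 : C4_curv mu 0 y z w = 0.
    by have := C4_curv_lin1 mu (-1) 0 0 y z w; rewrite scaler0 addr0; lra.
  by rewrite -[a *: x]addr0 C4_curv_lin1 Z0 addr0.
have Z3 a x y z w : C4_curv mu y z (a *: x) w = a * C4_curv mu y z x w.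
  have Z0 : C4_curv mu y z 0 w = 0.
    by have := C4_curv_lin3 mu (-1) 0 0 y z w; rewrite scaler0 addr0; lra.
  by rewrite -[a *: x]addr0 C4_curv_lin3 Z0 addr0.
have Z2 x z w : C4_curv mu x 0 z w = 0.
  by have := C4_curv_lin2 mu (-1) 0 0 x z w; rewrite scaler0 addr0; lra.
rewrite !Z1 !Z3 Z2 !C4_curv_delta !C4_compE /curv_int /= => E1.
have : mu ^+ 2 = 0 by lra.
by move/eqP; rewrite expf_eq0 /= (negbTE mu0).
Qed.

End modelled.

Theorem mainTheorem4 (R : realType) (mu : R) (hmu : mu <> 0%R) :
  ~ exists H : almost_hermitian R 4, inhabited H /\ modelled_on H (C4 mu).
Proof.
move=> [H [[P] [nabla [Rm [LC CT iso]]]]].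
(* Each isomorphism is paired with its inverse, so that a single choice at every point provides
   both. *)
have ex Q : exists f : {linear tangent Q -> 'rV[R]_4} * ('rV[R]_4 -> tangent Q),
  [/\ cancel f.1 f.2, cancel f.2 f.1,
      forall x y, C4_ip (f.1 x) (f.1 y) = metric x y &
      forall x y z w, C4_curv mu (f.1 x) (f.1 y) (f.1 z) (f.1 w) = Rm Q x y z w].
  by have [f [[g fK gK] ip _ cu]] := iso Q; exists (f, g).
have mu0 : mu != 0 by exact/eqP.
apply: (@not_modelled_at R mu mu0 H nabla LC Rm CT
  (fun Q => (sval (cid (ex Q))).1) (fun Q => (sval (cid (ex Q))).2)
  _ _ _ _ (chart_at P) (chart_at_atlas P) P (chart_at_dom P)) => Q.
all: by case: (svalP (cid (ex Q))).
Qed.
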